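(* There is an absolute constant $C$ such that for positive integers $k\le n$, in any $4$-graph $G$ on $n$ vertices with $e\ge Ckn^3$ edges one can find $t=\min\{k,d^{1/4}\}$ vertex-disjoint copies of $\mathit{St}_4(d,d,k)$, where $d=(n/k)^{1/3}$.
   Context: A $4$-graph is a $4$-uniform hypergraph. Generalised stars: $\mathit{St}_2(d)$ is the graph star with $d$ leaves; $\mathit{St}_r(d_1,\dots,d_{r-1})$ is the $r$-graph in which all edges contain a common vertex $v$ and removing $v$ from every edge yields $d_1$ vertex-disjoint copies of $\mathit{St}_{r-1}(d_2,\dots,d_{r-1})$. Non-integer quantities are rounded (floors and ceilings omitted). *)

(* Defs.v *)
From mathcomp Require Import all_boot.

Set Implicit Arguments.
Unset Strict Implicit.
Unset Printing Implicit Defensive.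

Record uhypergraph (r : nat) := UHypergraph {
  vertex :> finType;
  edge : {set {set vertex}};
  edge_card : {in edge, forall e : {set vertex}, #|e| = r}
}.

(* [f] exhibits a copy of [H] as a (not necessarily induced) subgraph of [G]. *)
Definition is_copy (r : nat) (H G : uhypergraph r) (f : H -> G) : Prop :=
  injective f /\ {in edge H, forall e : {set H}, f @: e \in edge G}.

Definition has_disjoint_copies (r t : nat) (H G : uhypergraph r) : Prop :=
  exists f : 'I_t -> H -> G,
    (forall i, is_copy (f i)) /\
    (forall i j, i != j -> [disjoint codom (f i) & codom (f j)]).

(* [star [:: d_1; ...; d_(r-1)]] is St_r(d_1, ..., d_(r-1)).  The common vertex
   of all edges is [None], and [Some (i, x)] is the vertex [x] in the [i]-th
   of the d_1 disjoint copies of St_(r-1)(d_2, ..., d_(r-1)).  The recursion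
   starts from St_1(), a single vertex forming an edge of size 1, which gives
   the graph star for r = 2 (lemma [star2_edgeE]). *)
Fixpoint star_vertex (ds : seq nat) : finType :=
  if ds is d :: ds' then option ('I_d * star_vertex ds')%type else unit.

Fixpoint star_edge (ds : seq nat) : {set {set star_vertex ds}} :=
  match ds return {set {set star_vertex ds}} with
  | [::] => [set [set tt]]
  | d :: ds' =>
      [set None |: [set Some (i, x) | x in e]
         | i : 'I_d, e : {set star_vertex ds'} in star_edge ds']
  end.

Lemma star_edge_card (ds : seq nat) :
  {in star_edge ds, forall e : {set star_vertex ds}, #|e| = (size ds).+1}.
Proof.
elim: ds => [|d ds IH] e /=; first by rewrite inE => /eqP->; rewrite cards1.
case/imset2P=> i e' _ e'E ->; rewrite cardsU1 card_imset => [|x y [] //].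
rewrite (IH _ e'E); case: imsetP => // -[x _]; discriminate.
Qed.

Definition star (ds : seq nat) : uhypergraph (size ds).+1 :=
  UHypergraph (@star_edge_card ds).

Lemma star2_edgeE (d : nat) :
  edge (star [:: d]) = [set [set None; Some (i, tt)] | i : 'I_d].
Proof.
apply/setP=> e; apply/imset2P/imsetP => [[i e' _]|[i _ ->]].
  by rewrite inE => /eqP-> ->; exists i; rewrite ?imset_set1.
by exists i [set tt]; rewrite ?inE ?imset_set1.
Qed.

(* Main.v *)
Require Import Defs.
From mathcomp Require Import all_boot all_order all_algebra.
From mathcomp Require Import boolp reals exp.
From mathcomp Require Import zify.

Set Implicit Arguments.
Unset Strict Implicit.
Unset Printing Implicit Defensive.

(* Write E v u w x when {v, u, w, x} is an edge, and suppose that there are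
   no t disjoint stars. A triple of large degree is heavy: the leaves of a
   star can be attached to it at the very end, whatever else has been used.
   Likewise a pair is rich if it lies in many heavy triples (a hub) or if
   its link contains d disjoint k-stars robustly. Fewer than t vertices can
   be centers in a robust way, and a small set meets all partial stars made
   of rich pairs or of heavy triples; apart from these, every vertex is in
   few rich pairs, its remaining heavy link is sparse, and so is its link
   without rich pairs and heavy triples.

   For t = 1 this holds at every vertex with nothing to be removed, and it
   gives e = O(k n^3): almost every edge has a vertex v such that the rich
   pairs and heavy triples of the edge at v do not obstruct the greedy
   search for a star centered at v. For general t, delete the vertex set S
   of a maximal family of disjoint stars. What is left contains no star, so
   it has O(k n^3) edges, while the degree bounds at the vertices of S show
   that only O(k n^3) edges are lost, because t <= k and t^4 <= d. *)

(** * Disjoint packings *)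

Section Packing.

Variable V : finType.
Implicit Types (A B S W : {set V}) (Q : {set V} -> Prop).

Lemma disjointUl A B S :
  [disjoint A :|: B & S] = [disjoint A & S] && [disjoint B & S].
Proof. by rewrite -!setI_eq0 setIUl setU_eq0. Qed.

Lemma disjointUr A B S :
  [disjoint S & A :|: B] = [disjoint S & A] && [disjoint S & B].
Proof. by rewrite disjoint_sym disjointUl !(disjoint_sym S). Qed.

Lemma sum_boolE (R : V -> bool) : \sum_x (R x : nat) = #|[set x | R x]|.
Proof.
by rewrite -sum1dep_card [RHS]big_mkcond /=; apply: eq_bigr => x _; case: (R x).
Qed.

Definition sing (R : V -> bool) A : Prop := exists2 x, R x & A = [set x].

(** A partial star is represented by its vertex set alone; the tree structure stays inside
    existential quantifiers, so disjointness and forbidden vertices are plain set conditions. *)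
Fixpoint pack Q n A : Prop :=
  if n is n'.+1 then
    exists A1 A2, [/\ Q A1, pack Q n' A2, [disjoint A1 & A2] & A = A1 :|: A2]
  else A = set0.

Definition node_at (Qf : V -> {set V} -> Prop) n x A : Prop :=
  exists B, [/\ pack (Qf x) n B, x \notin B & A = x |: B].

Definition node Qf n A : Prop := exists x, node_at Qf n x A.

(* [A] can be completed to a [Q']-set even if an adversary forbids [m] further
   vertices; this is what allows disjoint copies to be built level by level. *)
Definition ext m Q Q' : Prop :=
  forall A S, Q A -> [disjoint A & S] -> #|S| <= m ->
  exists A', [/\ Q' A', A \subset A' & [disjoint A' & S]].

Definition bounded c Q : Prop := forall A, Q A -> #|A| <= c.

Lemma bounded_sing R : bounded 1 (sing R).
Proof. by move=> A [x _ ->]; rewrite cards1. Qed.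

Lemma bounded_pack Q n c : bounded c Q -> bounded (n * c) (pack Q n).
Proof.
move=> Qc; elim: n => [|n IH] A /=; first by move=> ->; rewrite cards0.
case=> A1 [A2 [/Qc A1c /IH A2c _ ->]].
by rewrite mulSn (leq_trans (leq_card_setU _ _)) // leq_add.
Qed.

Lemma bounded_node Qf n c :
  (forall x, bounded c (Qf x)) -> bounded (n * c).+1 (node Qf n).
Proof.
move=> Qc A [x [B [/(bounded_pack (Qc x)) Bc _ ->]]].
by rewrite cardsU1 -add1n leq_add // leq_b1.
Qed.

(** Greedy choice: pick disjoint [Q]-sets outside [W] as long as possible. If this stops early, [S]
    is the union of the sets picked. The factor [n.-1] makes [S] empty when [n] is 1. *)
Lemma pack_or_block Q n c W : bounded c Q ->
  (exists2 A : {set V}, pack Q n A & [disjoint A & W]) \/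
  (exists2 S : {set V}, #|S| <= n.-1 * c &
     forall A, Q A -> ~~ [disjoint A & W :|: S]).
Proof.
move=> Qc; elim: n W => [|n IH] W /=.
  by left; exists set0 => //; rewrite -setI_eq0 set0I.
case: (pselect (exists2 A, Q A & [disjoint A & W])) => [[A QA AW]|nQ];
  last first.
  right; exists set0; first by rewrite cards0.
  by move=> A QA; apply/negP; rewrite setU0 => AW; apply: nQ; exists A.
case: n IH => [|n] IH.
  left; exists A => //; exists A, set0; split => //; last by rewrite setU0.
  by rewrite -setI_eq0 setI0.
case: (IH (W :|: A)) => [[B pB]|[S Sc nS]].
  rewrite disjointUr => /andP[BW BA]; left; exists (A :|: B).
    by exists A, B; split => //; rewrite disjoint_sym.
  by rewrite disjointUl AW BW.
right; exists (A :|: S); last by move=> B /nS; rewrite setUA.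
by rewrite mulSn (leq_trans (leq_card_setU _ _)) // leq_add // Qc.
Qed.

Lemma pack_sing (R : V -> bool) n S :
  n <= \sum_x (R x && (x \notin S) : nat) ->
  exists2 B : {set V}, pack (sing R) n B & [disjoint B & S].
Proof.
rewrite sum_boolE; elim: n S => [|n IH] S Rn.
  by exists set0 => //; rewrite -setI_eq0 set0I.
have [x] : exists x, x \in [set x | R x && (x \notin S)].
  by apply/set0Pn; rewrite -card_gt0; lia.
rewrite inE => /andP[Rx xS]; have [|B pB] := IH (x |: S).
  rewrite -ltnS (leq_trans Rn) // (cardsD1 x) inE Rx xS add1n ltnS.
  apply: subset_leq_card; apply/fintype.subsetP => y.
  by rewrite !inE negb_or => /andP[-> /andP[-> ->]].
rewrite disjointUr disjoint_sym disjoints1 => /andP[xB BS].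
exists (x |: B); last by rewrite disjointUl disjoints1 xS.
by exists [set x], B; split => //; [exists x | rewrite disjoints1].
Qed.

Lemma sum_notin (R : V -> bool) S :
  \sum_x (R x : nat) <= #|S| + \sum_x (R x && (x \notin S) : nat).
Proof.
rewrite -sum1_card [X in _ <= X + _]big_mkcond -big_split /=;
  apply: leq_sum => x _.
by case: (R x); case: (x \in S).
Qed.

(** The pieces are completed one at a time: the first avoids the part [A2] still to be completed,
    the others avoid the completed first piece. At most [n * c] vertices are ever forbidden besides
    [S]. *)
Lemma ext_pack m m' n c Q Q' : ext m Q Q' -> bounded c Q' ->
  m' + n * c <= m -> ext m' (pack Q n) (pack Q' n).
Proof.
move=> eQ Qc.
have Q1c : bounded c Q.
  move=> A QA; have [||A' [/Qc A'c AA' _]] := eQ A set0 QA.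
  - by rewrite -setI_eq0 setI0.
  - by rewrite cards0.
  exact: leq_trans (subset_leq_card AA') A'c.
elim: n m' => [|n IH] m'.
  by move=> _ A S /= -> AS Sm; exists set0.
rewrite mulSn => mm A S /= [A1 [A2 [QA1 pA2 A12 ->]]].
rewrite disjointUl => /andP[A1S A2S] Sm.
have A2c : #|A2| <= n * c by apply: bounded_pack pA2.
have [||B1 [QB1 AB1]] := eQ A1 (S :|: A2) QA1.
- by rewrite disjointUr A1S.
- by rewrite cardsU; lia.
rewrite disjointUr => /andP[B1S B1A2]; have B1c := Qc _ QB1.
have [|||B2 [pB2 AB2]] := IH (m' + c) _ A2 (S :|: B1) pA2.
- lia.
- by rewrite disjointUr A2S disjoint_sym.
- by rewrite cardsU; lia.
rewrite disjointUr => /andP[B2S B2B1].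
exists (B1 :|: B2); split; last by rewrite disjointUl B1S.
  by exists B1, B2; split => //; rewrite disjoint_sym.
exact: setUSS.
Qed.

Lemma ext_node m m' n c (Qf Qf' : V -> {set V} -> Prop) :
  (forall x, ext m (Qf x) (Qf' x)) -> (forall x, bounded c (Qf' x)) ->
  m' + (n * c).+1 <= m -> ext m' (node Qf n) (node Qf' n).
Proof.
move=> eQ Qc mm A S [x [B [pB xB ->]]]; rewrite disjointUl disjoints1.
case/andP=> xS BS Sm.
have eB : ext m'.+1 (pack (Qf x) n) (pack (Qf' x) n).
  by apply: ext_pack (eQ x) (Qc x) _; lia.
have [||B' [pB' BB']] := eB B (x |: S) pB.
- by rewrite disjointUr disjoint_sym disjoints1 xB.
- by rewrite cardsU1 xS; lia.
rewrite disjointUr disjoint_sym disjoints1 => /andP[xB' B'S].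
exists (x |: B'); split; first by exists x, B'.
  exact: setUS.
by rewrite disjointUl disjoints1 xS.
Qed.

(** The forbidden set and [x] itself take at most [m.+1] neighbours, which leaves [n] for the
    leaves. *)
Lemma ext_sing m n (P : V -> bool) (R : V -> V -> bool) :
  (forall x, P x -> m + n.+1 <= \sum_y (R x y : nat)) ->
  ext m (sing P) (node (fun x => sing (R x)) n).
Proof.
move=> PR A S [x Px ->]; rewrite disjoints1 => xS Sm.
have [|B pB] := @pack_sing (R x) n (x |: S).
  have := sum_notin (R x) (x |: S); have := PR x Px.
  by rewrite cardsU1 xS; lia.
rewrite disjointUr disjoint_sym disjoints1 => /andP[xB BS].
exists (x |: B); split; first by exists x, B.
  exact: subsetUl.
by rewrite disjointUl disjoints1 xS.
Qed.

Definition robust m (Qf : V -> {set V} -> Prop) n : {set V} :=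
  [set x | `[< forall S, #|S| <= m -> x \notin S ->
                exists2 A : {set V}, node_at Qf n x A & [disjoint A & S] >]].

Lemma ext_robust m Qf n :
  ext m (sing (mem (robust m Qf n))) (node Qf n).
Proof.
move=> A S [x /[!inE]/asboolP rx ->]; rewrite disjoints1 => xS Sm.
have [B nB BS] := rx S Sm xS; exists B; split => //; first by exists x.
by case: nB => C [_ _ ->]; apply: subsetUl.
Qed.

Lemma not_robust m Qf n x : x \notin robust m Qf n ->
  exists S : {set V}, [/\ #|S| <= m, x \notin S &
    forall A, node_at Qf n x A -> ~~ [disjoint A & S]].
Proof.
rewrite inE => /asboolPn /existsNP[S] /not_implyP[Sm] /not_implyP[xS nS].
by exists S; split => // A nA; apply/negP => AS; apply: nS; exists A.
Qed.

(** If there were [t] robust vertices, a budget of [t * c] would let them grow one after another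
    into disjoint nodes. *)
Lemma robust_lt m Qf n t c : bounded c (node Qf n) -> t * c <= m ->
  ~ (exists A, pack (node Qf n) t A) -> #|robust m Qf n| < t.
Proof.
move=> bQ tc nQ; rewrite ltnNge; apply/negP => tX; apply: nQ.
have [|B pB _] := @pack_sing (mem (robust m Qf n)) t set0.
  rewrite sum_boolE (leq_trans tX) // subset_leq_card //.
  by apply/fintype.subsetP => x; rewrite !inE andbT.
have eB : ext 0 (pack (sing (mem (robust m Qf n))) t) (pack (node Qf n) t).
  by apply: (ext_pack (@ext_robust m Qf n) bQ); rewrite add0n.
have [||A [pA _ _]] := eB B set0 pB.
- by rewrite -setI_eq0 setI0.
- by rewrite cards0.
by exists A.
Qed.

Lemma sum_in S (f : V -> nat) M : (forall x, f x <= M) ->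
  \sum_x (x \in S) * f x <= #|S| * M.
Proof.
move=> fM; rewrite -sum_nat_const [leqRHS]big_mkcond /=; apply: leq_sum => x _.
by case: (x \in S); rewrite ?mul1n ?mul0n.
Qed.

Lemma sum_all (f : V -> nat) M : (forall x, f x <= M) ->
  \sum_x f x <= #|V| * M.
Proof. by move=> fM; rewrite -sum_nat_const; apply: leq_sum. Qed.

(** [S] covers a maximal family of disjoint stars with [a] leaves in the graph [R]; a further vertex
    of large remaining degree would be the center of another one. *)
Lemma pack_node_block (R : V -> V -> bool) a b W :
  ~ (exists2 B : {set V},
       pack (node (fun w => sing (R w)) a) b B & [disjoint B & W]) ->
  exists2 S : {set V}, #|S| <= b * a.+1 &
    forall w, w \notin W -> w \notin S ->
      \sum_x (R w x && (x \notin W :|: S) : nat) <= a.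
Proof.
move=> nB.
have bQ : bounded a.+1 (node (fun w => sing (R w)) a).
  move=> A /(@bounded_node _ _ 1); rewrite muln1; apply => x.
  exact: bounded_sing.
case: (pack_or_block b W bQ) => [//|[S Sb nS]]; exists S.
  by rewrite (leq_trans Sb) // leq_mul2r leq_pred orbT.
move=> w wW wS; rewrite leqNgt; apply/negP => Rw.
(* The degree exceeds [a], and the spare unit pays for a possible loop at [w]. *)
have [|B pB] := @pack_sing (R w) a (w |: (W :|: S)).
  rewrite -ltnS (leq_trans Rw) // [leqLHS](bigD1 w) // [X in _ <= X.+1](bigD1
    w) //=.
  rewrite -add1n leq_add ?leq_b1 //.
  by apply: leq_trans (leq_addl _ _); apply: leq_sum => x /negPf xw;
    rewrite !inE xw.
rewrite disjointUr disjoint_sym disjoints1 => /andP[wB BW].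
have /negP[] := nS (w |: B) (ex_intro _ w (ex_intro _ B (And3 pB wB erefl))).
by rewrite disjointUl disjoints1 inE negb_or wW wS.
Qed.

(** Pairs meeting [S] lie in [#|S|] rows or [#|S|] columns of weight at most [D]; every other row
    keeps at most [a] pairs. *)
Lemma graph_sum (R : V -> V -> bool) S D a :
  (forall w, \sum_x (R w x : nat) <= D) ->
  (forall x, \sum_w (R w x : nat) <= D) ->
  (forall w, w \notin S -> \sum_x (R w x && (x \notin S) : nat) <= a) ->
  \sum_w \sum_x (R w x : nat) <= 2 * #|S| * D + #|V| * a.
Proof.
move=> R1 R2 RS.
have H1 := sum_in S R1; have H2 := sum_in S R2.
have H3 : \sum_w \sum_x ((w \notin S) && (R w x && (x \notin S)) : nat)
    <= #|V| * a.
  apply: sum_all => w; case: (boolP (w \in S)) => [_|/RS //].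
  by rewrite big1.
have -> : 2 * #|S| * D = #|S| * D + #|S| * D by lia.
apply: leq_trans (leq_add (leq_add H1 H2) H3).
under [X in _ + X + _]eq_bigr do rewrite big_distrr.
rewrite [X in _ + X + _]exchange_big -!big_split /=; apply: leq_sum => w _.
rewrite big_distrr -!big_split /=; apply: leq_sum => x _.
by case: (w \in S); case: (x \in S); case: (R w x).
Qed.

End Packing.

(** * Stars in a symmetric quaternary relation *)

Definition sym4 (V : Type) (E : V -> V -> V -> V -> bool) : Prop :=
  [/\ forall a b c x, E a b c x = E b a c x,
      forall a b c x, E a b c x = E a c b x
    & forall a b c x, E a b c x = E a b x c].

Section Stars.

Variables (V : finType) (E : V -> V -> V -> V -> bool) (k d t : nat).
Hypothesis symE : sym4 E.
Implicit Types (A B S W : {set V}) (a b c u v w x : V).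

Definition star3 v u := node (fun w => sing (E v u w)) k.
Definition star2 v := node (star3 v) d.
Definition star1 := node star2 d.

Definition star3_size := k.+1.
Definition star2_size := (d * star3_size).+1.
Definition star1_size := (d * star2_size).+1.
Definition fan_size := d.+1.
Definition heavy_star_size := (d * fan_size).+1.

(* The next three numbers are the budgets consumed when [t] disjoint partial
   stars are completed one level at a time. *)
Definition heavy_deg := t * star1_size + star1_size + star2_size + star3_size.
Definition hub_deg := t * heavy_star_size + heavy_star_size + fan_size.
Definition robust_budget := (t * star1_size + star1_size).+1.

Definition heavy v u w : bool := heavy_deg <= \sum_x (E v u w x : nat).
Definition hub v u : bool := hub_deg <= \sum_w (heavy v u w : nat).
(** The packing may use [v] and [u], which keeps the notion symmetric; both are avoided later by
    putting them into the forbidden set. *)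
Definition robust_pair v u : bool :=
  `[< forall S, #|S| <= robust_budget ->
        exists2 B, pack (star3 v u) d B & [disjoint B & S] >].
Definition rich v u := hub v u || robust_pair v u.

Definition heavy_star2 v := node (fun u => sing (heavy v u)) d.
Definition heavy_star := node heavy_star2 d.
Definition hub_star := node (fun v => sing (hub v)) d.
Definition robust_pair_star := node (fun v => sing (robust_pair v)) d.

Lemma E12 a b c x : E a b c x = E b a c x. Proof. by case: symE. Qed.
Lemma E23 a b c x : E a b c x = E a c b x. Proof. by case: symE. Qed.
Lemma E34 a b c x : E a b c x = E a b x c. Proof. by case: symE. Qed.

Lemma heavy12 a b c : heavy a b c = heavy b a c.
Proof. by congr (_ <= _); apply: eq_bigr => x _; rewrite E12. Qed.

Lemma heavy23 a b c : heavy a b c = heavy a c b.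
Proof. by congr (_ <= _); apply: eq_bigr => x _; rewrite E23. Qed.

Lemma rich_sym a b : rich a b = rich b a.
Proof.
congr (_ || _); first by congr (_ <= _); apply: eq_bigr => c _; rewrite heavy12.
have -> : robust_pair a b = robust_pair b a; last by [].
rewrite /robust_pair /star3; congr (`[< _ >]).
suff -> : E a b = E b a by [].
by apply/funext => c; apply/funext => x; rewrite E12.
Qed.

Lemma bounded_star3 v u : bounded star3_size (star3 v u).
Proof.
have := @bounded_node _ (fun w => sing (E v u w)) k 1.
by rewrite muln1; apply=> w; apply: bounded_sing.
Qed.

Lemma bounded_star2 v : bounded star2_size (star2 v).
Proof. by apply: bounded_node => u; apply: bounded_star3. Qed.

Lemma bounded_star1 : bounded star1_size star1.
Proof. by apply: bounded_node => v; apply: bounded_star2. Qed.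

Lemma bounded_fan (R : V -> V -> bool) :
  bounded fan_size (node (fun v => sing (R v)) d).
Proof.
have := @bounded_node _ (fun v => sing (R v)) d 1.
by rewrite muln1; apply=> w; apply: bounded_sing.
Qed.

Lemma bounded_heavy_star : bounded heavy_star_size heavy_star.
Proof. by apply: bounded_node => v; apply: bounded_fan. Qed.

(** Without [t] disjoint full stars there are then no [t] disjoint partial stars of kind [Q]
    either. *)
Definition completable Q : Prop :=
  forall A, pack Q t A -> exists B, pack star1 t B.

Lemma ext_completable Q : ext (t * star1_size) Q star1 -> completable Q.
Proof.
move=> eQ A pA; have eB : ext 0 (pack Q t) (pack star1 t).
  by apply: (ext_pack eQ bounded_star1); rewrite add0n.
have [||B [pB _ _]] := eB A set0 pA; last by exists B.
  by rewrite -setI_eq0 setI0.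
by rewrite cards0.
Qed.

Lemma completable_star1 : completable star1.
Proof. by move=> A; exists A. Qed.

(** Only the leaves are missing. The summands of [heavy_deg] pay in turn for the [t] stars, the
    current star, its current branch, and the [k] new leaves with their center. *)
Lemma completable_heavy_star : completable heavy_star.
Proof.
apply: ext_completable.
apply: (@ext_node _ (t * star1_size + star1_size) _ _ star2_size) => //;
  last exact: bounded_star2.
move=> v; apply: (@ext_node _ (t * star1_size + star1_size + star2_size) _ _
  star3_size) => // u.
  exact: ext_sing.
exact: bounded_star3.
Qed.

(** Two rounds: hubs are first expanded into heavy triples, and the resulting heavy stars then
    receive their leaves. *)
Lemma completable_hub_star : completable hub_star.
Proof.
move=> A pA; suff [B] : exists B, pack heavy_star t B by apply:
  completable_heavy_star.
have eQ : ext (t * heavy_star_size) hub_star heavy_star.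
  apply: (@ext_node _ (t * heavy_star_size + heavy_star_size) _ _ fan_size) =>
    // v; last exact: bounded_fan.
  exact: ext_sing.
have eB : ext 0 (pack hub_star t) (pack heavy_star t).
  by apply: (ext_pack eQ bounded_heavy_star); rewrite add0n.
have [||B [pB _ _]] := eB A set0 pA; last by exists B.
  by rewrite -setI_eq0 setI0.
by rewrite cards0.
Qed.

Lemma completable_robust_pair_star : completable robust_pair_star.
Proof.
apply: ext_completable.
apply: (@ext_node _ (t * star1_size + star1_size) _ _ star2_size) => // v;
  last exact: bounded_star2.
move=> A S [u /asboolP Pvu ->]; rewrite disjoints1 => uS Sm.
(* The successor in [robust_budget] pays for forbidding [u]. *)
have [|B pB] := Pvu (u |: S); first by rewrite cardsU1 uS.
rewrite disjointUr disjoint_sym disjoints1 => /andP[uB BS].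
exists (u |: B); split; first by exists u, B.
  exact: subsetUl.
by rewrite disjointUl disjoints1 uS.
Qed.

Definition blocked (Qf : V -> {set V} -> Prop) v W : Prop :=
  v \notin W /\ forall A, node_at Qf d v A -> ~~ [disjoint A & W].

(** Two kinds of blocking sets arise: a vertex that is not robust has a private set [W], while a
    maximal disjoint family gives one common set [Z], valid at every vertex outside it. For [t]
    equal to 1 the set [Z] is empty. *)
Lemma sparse_core Qf m : bounded m (node Qf d) -> completable (node Qf d) ->
  ~ (exists A, pack star1 t A) ->
  [/\ #|robust (t * m) Qf d| < t,
      forall v, v \notin robust (t * m) Qf d ->
        exists2 W : {set V}, #|W| <= t * m & blocked Qf v W
    & exists2 Z : {set V}, #|Z| <= t.-1 * m &
        forall v W, v \notin W -> Z \subset W -> blocked Qf v W].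
Proof.
move=> Qc cQ nS; have nQ : ~ (exists A, pack (node Qf d) t A).
  by case=> A /cQ.
split; first exact: robust_lt Qc _ nQ.
  by move=> v /not_robust[W [Wc vW nW]]; exists W.
have [[A pA]|[Z Zc nZ]] := pack_or_block t set0 Qc.
  by case: nQ; exists A.
exists Z => // v W vW ZW; split=> // A nA; have /nZ : node Qf d A by exists v.
by rewrite set0U; apply: contra; apply: disjointWr.
Qed.

Lemma blocked_fan (R : V -> V -> bool) v W : blocked (fun v => sing (R v)) v W
  ->
  \sum_u (R v u && (u \notin W) : nat) <= d.
Proof.
case=> vW nW; rewrite leqNgt; apply/negP => Rd.
have [|B pB] := @pack_sing _ (R v) d (v |: W).
  rewrite -ltnS (leq_trans Rd) // [leqLHS](bigD1 v) // [X in _ <= X.+1](bigD1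
    v) //=.
  rewrite -add1n leq_add ?leq_b1 //.
  apply: leq_trans (leq_addl _ _); apply: leq_sum => u /negPf uv.
  by rewrite !inE uv.
rewrite disjointUr disjoint_sym disjoints1 => /andP[vB BW].
have /negP[] := nW (v |: B) (ex_intro _ B (And3 pB vB erefl)).
by rewrite disjointUl disjoints1 vW.
Qed.

Lemma blocked_heavy_star2 v W : blocked heavy_star2 v W ->
  exists2 S : {set V}, #|S| <= heavy_star_size &
    forall u, u \notin W -> u \notin S ->
      \sum_w (heavy v u w && (w \notin W :|: S) : nat) <= d.
Proof.
case=> vW nW; have [|S Sc nS] := @pack_node_block V (heavy v) d d (v |: W).
  case=> B pB; rewrite disjointUr disjoint_sym disjoints1 => /andP[vB BW].
  have /negP[] := nW (v |: B) (ex_intro _ B (And3 pB vB erefl)).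
  by rewrite disjointUl disjoints1 vW.
exists (v |: S); first by rewrite cardsU1 /heavy_star_size -add1n leq_add
  ?leq_b1.
move=> u uW; rewrite !inE negb_or => /andP[uv uS].
have -> : W :|: (v |: S) = v |: W :|: S by rewrite setUCA setUA.
by apply: nS => //; rewrite !inE negb_or uv.
Qed.

(** Failure of robustness gives [S] such that the link of the pair has no [d] disjoint [k]-stars
    outside [S]. Adding a maximal family of such stars to [S] leaves degrees at most [k]. *)
Lemma pair_sum (G : V -> V -> bool) v u D : ~~ robust_pair v u ->
  (forall w x, G w x -> E v u w x) ->
  (forall w, \sum_x (G w x : nat) <= D) ->
  (forall x, \sum_w (G w x : nat) <= D) ->
  \sum_w \sum_x (G w x : nat) <= 2 * (robust_budget + d * star3_size) * D +
    #|V| * k.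
Proof.
move=> /asboolPn/existsNP[S] /not_implyP[Sr nS] GE G1 G2.
have [|S' S'c nS'] := @pack_node_block V (E v u) k d S; first exact: nS.
have GS w : w \notin S :|: S' ->
    \sum_x (G w x && (x \notin S :|: S') : nat) <= k.
  rewrite inE negb_or => /andP[wS wS']; apply: leq_trans (nS' w wS wS').
  apply: leq_sum => x _; case: (x \notin _); rewrite ?andbF ?andbT //.
  by case: (boolP (G w x)) => // /GE ->.
apply: leq_trans (graph_sum G1 G2 GS) _; rewrite leq_add2r leq_mul2r leq_mul2l.
by apply/orP; right; rewrite cardsU; rewrite /star3_size; lia.
Qed.

(** The argument of [pair_sum] one level up. A maximal family of branches at [v], together with [W]
    and [v], forms [U]. Triples meeting [U] are counted by [M], once per position; for [u] outside
    [U] no further branch starts at [u], so [graph_sum] bounds what remains. *)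
Lemma link_sum (F : V -> V -> V -> bool) v W M D :
  blocked star2 v W ->
  (forall u w x, F u w x -> E v u w x) ->
  (forall u, \sum_w \sum_x (F u w x : nat) <= M) ->
  (forall w, \sum_u \sum_x (F u w x : nat) <= M) ->
  (forall x, \sum_u \sum_w (F u w x : nat) <= M) ->
  (forall u w, \sum_x (F u w x : nat) <= D) ->
  (forall u x, \sum_w (F u w x : nat) <= D) ->
  \sum_u \sum_w \sum_x (F u w x : nat) <=
    3 * (#|W| + star2_size.+1 * d.+1) * M
    + #|V| * (2 * star2_size * D + #|V| * k).
Proof.
case=> vW nW FE F1 F2 F3 F4 F5.
have [[B pB]|[S Sc nS]] := pack_or_block d (v |: W) (@bounded_star2 v).
  rewrite disjointUr disjoint_sym disjoints1 => /andP[vB BW].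
  have /negP[] := nW (v |: B) (ex_intro _ B (And3 pB vB erefl)).
  by rewrite disjointUl disjoints1 vW.
set U := v |: W :|: S in nS.
have Uc : #|U| <= #|W| + star2_size.+1 * d.+1.
  rewrite cardsU cardsU1 vW; have := leq_pred d; nia.
have FU u : u \notin U ->
  \sum_w \sum_x (F u w x && (w \notin U) && (x \notin U) : nat)
    <= 2 * star2_size * D + #|V| * k.
  move=> uU; have [|S' S'c nS'] := @pack_node_block V (E v u) k d (u |: U).
    case=> B pB; rewrite disjointUr disjoint_sym disjoints1 => /andP[uB BU].
    have /negP[] := nS (u |: B) (ex_intro _ u (ex_intro _ B (And3 pB uB
      erefl))).
    by rewrite disjointUl disjoints1 uU.
  have G1 w : \sum_x (F u w x && (w \notin U) && (x \notin U) : nat) <= D.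
    apply: leq_trans (F4 u w); apply: leq_sum => x _.
    by case: (F u w x); rewrite //= leq_b1.
  have G2 x : \sum_w (F u w x && (w \notin U) && (x \notin U) : nat) <= D.
    apply: leq_trans (F5 u x); apply: leq_sum => w _.
    by case: (F u w x); rewrite //= leq_b1.
  have GS w : w \notin u |: S' ->
    \sum_x (F u w x && (w \notin U) && (x \notin U) && (x \notin u |: S') : nat)
      <= k.
    rewrite in_setU1 negb_or => /andP[wu wS'].
    case: (boolP (w \in U)) => [wU|wU].
      by rewrite big1 // => x _; rewrite andbF.
    have := nS' w; rewrite in_setU1 negb_or wu wU => /(_ isT wS').
    apply: leq_trans; apply: leq_sum => x _.
    case: (boolP (F u w x)) => // /FE ->;
      rewrite (in_setU x (u |: U)) !in_setU1 !negb_or.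
    by case: (x == u); case: (x \in U); case: (x \in S').
  apply: leq_trans (graph_sum G1 G2 GS) _;
    rewrite leq_add2r leq_mul2r leq_mul2l.
  apply/orP; right; rewrite /= cardsU1; rewrite /star2_size /star3_size.
  by apply: leq_trans (_ : 1 + #|S'| <= _); rewrite ?leq_add2r ?leq_b1 ?add1n.
have H1 := sum_in U F1; have H2 := sum_in U F2; have H3 := sum_in U F3.
have H4 : \sum_u \sum_w \sum_x
    ((u \notin U) && (F u w x && (w \notin U) && (x \notin U)) : nat)
    <= #|V| * (2 * star2_size * D + #|V| * k).
  apply: sum_all => u; case: (boolP (u \in U)) => [_|/FU //].
  by rewrite big1 // => w _; rewrite big1.
have HM : 3 * #|U| * M <= 3 * (#|W| + star2_size.+1 * d.+1) * M.
  by rewrite leq_mul2r leq_mul2l Uc !orbT.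
apply: leq_trans (leq_add HM H4).
have -> : 3 * #|U| * M = #|U| * M + #|U| * M + #|U| * M by lia.
apply: leq_trans (leq_add (leq_add (leq_add H1 H2) H3) (leqnn _)).
have E1 : \sum_u (u \in U) * \sum_w \sum_x (F u w x : nat) =
   \sum_u \sum_w \sum_x (u \in U) * F u w x.
  apply: eq_bigr => u _; rewrite big_distrr; apply: eq_bigr => w _.
  by rewrite big_distrr.
have E2 : \sum_w (w \in U) * \sum_u \sum_x (F u w x : nat) =
   \sum_u \sum_w \sum_x (w \in U) * F u w x.
  rewrite exchange_big; apply: eq_bigr => w _; rewrite big_distrr.
  by apply: eq_bigr => u _; rewrite big_distrr.
have E3 : \sum_x (x \in U) * \sum_u \sum_w (F u w x : nat) =
   \sum_u \sum_w \sum_x (x \in U) * F u w x.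
  under [RHS]eq_bigr do rewrite exchange_big.
  rewrite [RHS]exchange_big; apply: eq_bigr => x _; rewrite big_distrr.
  by apply: eq_bigr => u _; rewrite big_distrr.
rewrite E1 E2 E3 -!big_split; apply: leq_sum => u _.
rewrite -!big_split; apply: leq_sum => w _.
rewrite -!big_split; apply: leq_sum => x _ /=.
by case: (u \in U); case: (w \in U); case: (x \in U); case: (F u w x).
Qed.

(** [Y] marks the pairs [w], [x] whose triple with [v] may still be heavy. It is [rich] in the
    classification of edges and empty when the edges at a single vertex are counted. *)
Definition light (Y : V -> V -> bool) v u w x : bool :=
  [&& E v u w x, ~~ rich v u, ~~ rich v w, ~~ rich v x, ~~ heavy v u w, ~~
    heavy v u x
    & heavy v w x ==> Y w x].

Definition pair_bound p := 2 * (robust_budget + d * star3_size) * heavy_deg +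
  #|V| * k + #|V| * p.

(** The link is symmetric in [w] and [x], but [u] plays a special part. For fixed [w], the triple
    [v], [w], [x] can be heavy only for the at most [p] vertices [x] with [Y w x]; these give the
    term [#|V| * p] of [pair_bound], and [pair_sum] covers the rest. *)
Lemma light_sum (Y : V -> V -> bool) v W p : blocked star2 v W ->
  (forall a b, Y a b = Y b a) -> (forall a, \sum_b (Y a b : nat) <= p) ->
  \sum_u \sum_w \sum_x (light Y v u w x : nat) <=
    3 * (#|W| + star2_size.+1 * d.+1) * pair_bound p
    + #|V| * (2 * star2_size * heavy_deg + #|V| * k).
Proof.
move=> bW Ysym Yp; set F := light Y v.
have FE u w x : F u w x -> E v u w x by case/andP.
have Fsym u w x : F u w x = F u x w.
  rewrite /F /light E34 [heavy v w x]heavy23 Ysym.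
  by case: (E v u x w); case: (rich v u); case: (rich v w); case: (rich v x);
    case: (heavy v u w); case: (heavy v u x).
have Esum a b c : ~~ heavy a b c -> \sum_x (E a b c x : nat) <= heavy_deg.
  by rewrite -ltnNge => /ltnW.
have F4 u w : \sum_x (F u w x : nat) <= heavy_deg.
  case: (boolP (heavy v u w)) => [h|/Esum].
    by rewrite big1 // => x _; rewrite /F /light h !andbF.
  apply: leq_trans; apply: leq_sum => x _.
  by case: (boolP (F u w x)) => // /FE ->.
have F5 u x : \sum_w (F u w x : nat) <= heavy_deg.
  by under eq_bigr do rewrite Fsym; apply: F4.
have PP a : ~~ rich v a -> ~~ robust_pair v a by rewrite negb_or => /andP[].
have F2 w : \sum_u \sum_x (F u w x : nat) <= pair_bound p.
  case: (boolP (rich v w)) => [h|/PP nP].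
    by rewrite big1 // => u _; rewrite big1 // => x _;
      rewrite /F /light h !andbF.
  have G1 u : \sum_x (F u w x && ~~ heavy v w x : nat) <= heavy_deg.
    by apply: leq_trans (F4 u w); apply: leq_sum => x _; case: (F u w x);
      rewrite ?leq_b1.
  have G2 x : \sum_u (F u w x && ~~ heavy v w x : nat) <= heavy_deg.
    case: (boolP (heavy v w x)) => [_|/Esum].
      by rewrite big1 // => u _; rewrite andbF.
    apply: leq_trans; apply: leq_sum => u _; rewrite andbT.
    by case: (boolP (F u w x)) => // /FE; rewrite E23 E34 => ->.
  have GE u x : F u w x && ~~ heavy v w x -> E v w u x.
    by case/andP=> /FE; rewrite E23.
  have HY : \sum_(u : V) \sum_x (Y w x : nat) <= #|V| * p.
    by apply: sum_all => u.
  apply: leq_trans (leq_add (pair_sum nP GE G1 G2) HY).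
  rewrite -big_split; apply: leq_sum => u _.
  rewrite -big_split; apply: leq_sum => x _ /=.
  case: (boolP (F u w x)) => // /and5P[_ _ _ _ /and3P[_ _]].
  by case: (heavy v w x) => //= ->.
apply: (link_sum bW FE) => // [u|x].
  case: (boolP (rich v u)) => [h|/PP nP].
    by rewrite big1 // => w _; rewrite big1 // => x _;
      rewrite /F /light h !andbF.
  exact: leq_trans (pair_sum nP (FE u) (F4 u) (F5 u)) (leq_addr _ _).
apply: leq_trans (F2 x); rewrite leq_eqVlt; apply/orP; left; apply/eqP.
by apply: eq_bigr => u _; apply: eq_bigr => w _; rewrite Fsym.
Qed.

End Stars.

(** * Classification of the edges *)

Section Reorderings.

Variable V : finType.
Implicit Types x y z w : V.

Definition any2 (f : V -> V -> bool) x y := f x y || f y x.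
Definition any3 (f : V -> V -> V -> bool) x y z :=
  [|| any2 (f x) y z, any2 (f y) x z | any2 (f z) x y].
Definition any4 (f : V -> V -> V -> V -> bool) w x y z :=
  [|| any3 (f w) x y z, any3 (f x) w y z, any3 (f y) w x z | any3 (f z) w x y].

Lemma sum_any2 f :
  \sum_x \sum_y (any2 f x y : nat) <= 2 * \sum_x \sum_y (f x y : nat).
Proof.
have -> : 2 * \sum_x \sum_y (f x y : nat) =
  \sum_x \sum_y (f x y : nat) + \sum_y \sum_x (f x y : nat).
  by rewrite [X in _ = _ + X]exchange_big mul2n addnn.
rewrite -big_split; apply: leq_sum => x _.
rewrite -big_split; apply: leq_sum => y _.
by rewrite /any2; case: (f x y); case: (f y x).
Qed.

Lemma sum_any3 f :
  \sum_x \sum_y \sum_z (any3 f x y z : nat) <=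
    6 * \sum_x \sum_y \sum_z (f x y z : nat).
Proof.
pose g x y z := any2 (f x) y z.
have Hg : \sum_x \sum_y \sum_z (g x y z : nat) <=
    2 * \sum_x \sum_y \sum_z (f x y z : nat).
  by rewrite big_distrr; apply: leq_sum => x _; apply: sum_any2.
apply: leq_trans (_ : 3 * \sum_x \sum_y \sum_z (g x y z : nat) <= _);
  last by lia.
have -> : 3 * \sum_x \sum_y \sum_z (g x y z : nat) =
  \sum_x \sum_y \sum_z (g x y z : nat) + \sum_x \sum_y \sum_z (g y x z : nat)
  + \sum_x \sum_y \sum_z (g z x y : nat).
  rewrite [\sum_x \sum_y \sum_z (g y x z : nat)]exchange_big /=.
  have -> : \sum_x \sum_y \sum_z (g z x y : nat) =
      \sum_x \sum_y \sum_z (g x y z : nat); last by lia.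
  under eq_bigr do rewrite exchange_big.
  by rewrite exchange_big.
rewrite -!big_split; apply: leq_sum => x _.
rewrite -!big_split; apply: leq_sum => y _.
rewrite -!big_split; apply: leq_sum => z _.
by rewrite /any3 -!/(g _ _ _); case: (g x y z); case: (g y x z);
  case: (g z x y).
Qed.

Lemma sum_any4 f :
  \sum_w \sum_x \sum_y \sum_z (any4 f w x y z : nat) <=
    24 * \sum_w \sum_x \sum_y \sum_z (f w x y z : nat).
Proof.
pose g w x y z := any3 (f w) x y z.
pose N := \sum_w \sum_x \sum_y \sum_z (g w x y z : nat).
have Hg : N <= 6 * \sum_w \sum_x \sum_y \sum_z (f w x y z : nat).
  by rewrite big_distrr; apply: leq_sum => x _; apply: sum_any3.
apply: leq_trans (_ : 4 * N <= _); last by lia.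
have -> : 4 * N = N + \sum_w \sum_x \sum_y \sum_z (g x w y z : nat)
  + \sum_w \sum_x \sum_y \sum_z (g y w x z : nat)
  + \sum_w \sum_x \sum_y \sum_z (g z w x y : nat).
  have -> : \sum_w \sum_x \sum_y \sum_z (g x w y z : nat) = N.
    by rewrite exchange_big.
  have -> : \sum_w \sum_x \sum_y \sum_z (g y w x z : nat) = N.
    under eq_bigr do rewrite exchange_big.
    by rewrite exchange_big.
  have -> : \sum_w \sum_x \sum_y \sum_z (g z w x y : nat) = N; last by lia.
  under eq_bigr => w _ do under eq_bigr do rewrite exchange_big.
  under eq_bigr do rewrite exchange_big.
  by rewrite exchange_big.
rewrite /N -!big_split; apply: leq_sum => w _.
rewrite -!big_split; apply: leq_sum => x _.
rewrite -!big_split; apply: leq_sum => y _.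
rewrite -!big_split; apply: leq_sum => z _.
rewrite /any4 -!/(g _ _ _ _).
by case: (g w x y z); case: (g x w y z); case: (g y w x z); case: (g z w x y).
Qed.

(** Whichever ordering satisfies [f] also satisfies the symmetric [E]; thus an edge can be charged
    to the ordering that suits a class. *)
Lemma any4_sym (E f : V -> V -> V -> V -> bool) a b c x : sym4 E ->
  E a b c x -> any4 f a b c x ->
  any4 (fun a b c x => E a b c x && f a b c x) a b c x.
Proof.
case=> E12 E23 E34 Ex.
have any2E g y z (e : V -> V -> bool) : e y z = e z y -> e y z -> any2 g y z ->
    any2 (fun y z => e y z && g y z) y z.
  by rewrite /any2 => <- ->.
have any3E g y z w (e : V -> V -> V -> bool) :
    (forall a b c, e a b c = e b a c) -> (forall a b c, e a b c = e a c b) ->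
    e y z w -> any3 g y z w ->
    any3 (fun y z w => e y z w && g y z w) y z w.
  move=> e12 e23 eyzw /or3P[] h; apply/or3P.
  - by apply: Or31; apply: any2E.
  - by apply: Or32; apply: any2E => //; rewrite e12.
  - by apply: Or33; apply: any2E => //; rewrite e12 e23.
case/or4P => h; apply/or4P.
- by apply: Or41; apply: any3E.
- by apply: Or42; apply: any3E => //; rewrite E12.
- by apply: Or43; apply: any3E => //; rewrite E12 E23.
- by apply: Or44; apply: any3E => //; rewrite E12 E23 E34.
Qed.

End Reorderings.

(** * Sparse heavy links and the count over the edge classes *)

Section Sparse.

Variables (V : finType) (E : V -> V -> V -> V -> bool) (k d t : nat).
Hypothesis symE : sym4 E.
Implicit Types (W S : {set V}) (a b c u v w x : V).
Local Notation heavy := (heavy E k d t).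
Local Notation hub := (hub E k d t).
Local Notation rich := (rich E k d t).
Local Notation hub_deg := (hub_deg d t).
Local Notation heavy_star2 := (heavy_star2 E k d t).
Local Notation light := (light E k d t).

(** Dropping rich pairs removes the hubs, which bounds all degrees of this graph by [hub_deg]. *)
Definition heavy_link v u w := [&& heavy v u w, ~~ rich v u & ~~ rich v w].

Lemma heavy_link_sym v u w : heavy_link v u w = heavy_link v w u.
Proof. by rewrite /heavy_link (heavy23 _ _ _ symE) [~~ rich v u && _]andbC. Qed.

Lemma heavy_link_row v u : \sum_w (heavy_link v u w : nat) <= hub_deg.
Proof.
case: (boolP (hub v u)) => [h|].
  by rewrite big1 // => w _; rewrite /heavy_link /rich h andbF.
rewrite -ltnNge => /ltnW; apply: leq_trans; apply: leq_sum => w _.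
by rewrite /heavy_link; case: (heavy v u w); rewrite ?leq_b1.
Qed.

Lemma heavy_link_col v w : \sum_u (heavy_link v u w : nat) <= hub_deg.
Proof. by under eq_bigr do rewrite heavy_link_sym; apply: heavy_link_row. Qed.

Lemma heavy_link_core v W : blocked d heavy_star2 v W ->
  exists2 S : {set V}, #|S| <= heavy_star_size d &
    forall u, u \notin W -> u \notin S ->
      \sum_w (heavy_link v u w && (w \notin W :|: S) : nat) <= d.
Proof.
move=> /(blocked_heavy_star2)[S Sc nS]; exists S => // u uW uS.
apply: leq_trans (nS u uW uS); apply: leq_sum => w _.
rewrite /heavy_link; case: (heavy v u w) => //=.
by case: (~~ rich v u); case: (~~ rich v w).
Qed.

Lemma heavy_link_sum v W : blocked d heavy_star2 v W ->
  \sum_u \sum_w (heavy_link v u w : nat) <= 2 * (#|W| + heavy_star_size d) *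
    hub_deg + #|V| * d.
Proof.
move=> /heavy_link_core[S Sc nS].
have WS u : u \notin W :|: S ->
    \sum_w (heavy_link v u w && (w \notin W :|: S) : nat) <= d.
  by rewrite inE negb_or => /andP[uW uS]; apply: nS.
apply: leq_trans (graph_sum (heavy_link_row v) (heavy_link_col v) WS) _.
rewrite leq_add2r leq_mul2r leq_mul2l cardsU; apply/orP; right; lia.
Qed.

(** Pairs meeting [W] are left out, so the bound does not involve [#|W|]. This is the gain from
    deleting the common blocking set. *)
Lemma heavy_link_sum_avoiding v W : blocked d heavy_star2 v W ->
  \sum_u \sum_w (heavy_link v u w && (u \notin W) && (w \notin W) : nat) <=
    2 * heavy_star_size d * hub_deg + #|V| * d.
Proof.
move=> /heavy_link_core[S Sc nS].
have G1 u : \sum_w (heavy_link v u w && (u \notin W) && (w \notin W) : nat) <=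
  hub_deg.
  apply: leq_trans (heavy_link_row v u); apply: leq_sum => w _.
  by case: (heavy_link v u w); rewrite //= leq_b1.
have G2 w : \sum_u (heavy_link v u w && (u \notin W) && (w \notin W) : nat) <=
  hub_deg.
  apply: leq_trans (heavy_link_col v w); apply: leq_sum => u _.
  by case: (heavy_link v u w); rewrite //= leq_b1.
have GS u : u \notin S ->
    \sum_w (heavy_link v u w && (u \notin W) && (w \notin W) && (w \notin S) :
      nat) <= d.
  case: (boolP (u \in W)) => [_ _|uW uS].
    by rewrite big1 // => w _; rewrite andbF.
  apply: leq_trans (nS u uW uS); apply: leq_sum => w _.
  by rewrite in_setU negb_or andbT andbA.
apply: leq_trans (graph_sum G1 G2 GS) _.
by rewrite leq_add2r leq_mul2r leq_mul2l Sc !orbT.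
Qed.

(** This is a sum of squared degrees. Outside [S] a degree is the part [h u] going into [S] plus at
    most [d], and the parts [h u] add up to at most [#|S| * hub_deg]. *)
Lemma heavy_link_cherries v : blocked d heavy_star2 v set0 ->
  \sum_u \sum_w \sum_x (heavy_link v u w && heavy_link v u x : nat) <=
    3 * heavy_star_size d * (hub_deg * hub_deg) + #|V| * (d * d).
Proof.
move=> /heavy_link_core[S Sc nS].
pose h u := \sum_w (w \in S) * heavy_link v u w.
have Hh : \sum_u h u <= #|S| * hub_deg.
  rewrite /h exchange_big /=; apply: leq_trans (sum_in S (heavy_link_col v)).
  by apply: leq_sum => w _; rewrite big_distrr.
have Hu u : \sum_w \sum_x (heavy_link v u w && heavy_link v u x : nat) <=
    (u \in S) * (hub_deg * hub_deg) + 2 * hub_deg * h u + d * d.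
  pose g := \sum_w (heavy_link v u w : nat).
  have -> : \sum_w \sum_x (heavy_link v u w && heavy_link v u x : nat) = g * g.
    rewrite [RHS]big_distrl; apply: eq_bigr => w _ /=; rewrite big_distrr.
    by apply: eq_bigr => x _; case: (heavy_link v u w);
      case: (heavy_link v u x).
  have gq : g <= hub_deg := heavy_link_row v u.
  case: (boolP (u \in S)) => [_|uS].
    by apply: leq_trans (leq_addr _ _); apply: leq_trans (leq_addr _ _);
      rewrite mul1n leq_mul.
  pose l := \sum_w (heavy_link v u w && (w \notin set0 :|: S) : nat).
  have ld : l <= d by apply: nS => //; rewrite inE.
  have ghl : g = h u + l.
    rewrite -big_split; apply: eq_bigr => w _ /=; rewrite set0U.
    by case: (heavy_link v u w); case: (w \in S).
  rewrite mul0n add0n; nia.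
apply: leq_trans (leq_sum _ (fun u _ => Hu u)) _.
have SQ : 3 * #|S| * (hub_deg * hub_deg) <= 3 * heavy_star_size d * (hub_deg *
  hub_deg).
  by rewrite leq_mul2r leq_mul2l Sc !orbT.
apply: leq_trans (leq_add SQ (leqnn _)).
have -> : 3 * #|S| * (hub_deg * hub_deg) = #|S| * (hub_deg * hub_deg) + 2 *
  hub_deg * (#|S| * hub_deg) by lia.
rewrite 2!big_split; apply: leq_add; last by apply: sum_all => u.
apply: leq_add; first by apply: (sum_in S) => u.
by rewrite -big_distrr leq_mul2l Hh orbT.
Qed.

Definition sparse_class a b c x :=
  [|| rich a b && rich c x, rich a b && rich a c, heavy_link a b c &&
    heavy_link a b x, heavy_link a b c && rich b x
    | [&& ~~ rich a b, ~~ rich a c, ~~ rich a x, ~~ heavy a b c, ~~ heavy a b x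
        & heavy a c x ==> rich c x]].

(* An edge with two rich pairs is in one of the first two classes.  Otherwise
   two heavy triples sharing a vertex on no rich pair give the third class, a
   rich pair sticking out of a heavy triple gives the fourth, and any other edge
   has a vertex suitable for the last one. *)
Lemma any_sparse_class a b c x : any4 sparse_class a b c x.
Proof.
have Ps y z : rich y z = rich z y by apply: rich_sym.
have Ts y z w : (heavy z y w = heavy y z w) * (heavy y w z = heavy y z w) *
  (heavy z w y = heavy y z w)
    * (heavy w y z = heavy y z w) * (heavy w z y = heavy y z w).
  have h12 := heavy12 k d t symE; have h23 := heavy23 k d t symE.
  by rewrite h12 [heavy y w z]h23 [heavy z w y]h23 [heavy z y w]h12 [heavy w y
    z]h12
    [heavy y w z]h23 [heavy w z y]h23 [heavy w y z]h12 [heavy y w z]h23.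
rewrite /any4 /any3 /any2 /sparse_class /heavy_link.
rewrite !(Ps b a) !(Ps c a) !(Ps x a) !(Ps c b) !(Ps x b) !(Ps x c).
rewrite !(Ts a b c) !(Ts a b x) !(Ts a c x) !(Ts b c x).
(* With all arguments sorted by symmetry, six pairs and four triples remain and the claim is
   propositional. *)
move: (rich a b) (rich a c) (rich a x) (rich b c) (rich b x) (rich c x).
move: (heavy a b c) (heavy a b x) (heavy a c x) (heavy b c x).
by do 10!case.
Qed.

(** The summands follow the classes of [sparse_class], the first two classes sharing the first
    summand; 24 is the number of orderings of an edge. *)
Lemma sum_sparse p :
  (forall v, [/\ blocked d (star2 E k d) v set0, blocked d heavy_star2 v set0
               & \sum_u (rich v u : nat) <= p]) ->
  \sum_a \sum_b \sum_c \sum_x (E a b c x : nat) <= 24 * (#|V| *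
    (2 * (#|V| * (p * p)) + (3 * heavy_star_size d * (hub_deg * hub_deg) + #|V|
      * (d * d))
     + (2 * heavy_star_size d * hub_deg + #|V| * d) * p
     + (3 * ((star2_size k d).+1 * d.+1) * pair_bound V k d t p
        + #|V| * (2 * star2_size k d * heavy_deg k d t + #|V| * k)))).
Proof.
move=> bl; have Pp v : \sum_u (rich v u : nat) <= p by case: (bl v).
pose K a b c x := E a b c x && sparse_class a b c x.
apply: leq_trans (_ : 24 * \sum_a \sum_b \sum_c \sum_x (K a b c x : nat) <= _).
  apply: leq_trans (sum_any4 K); apply: leq_sum => a _; apply: leq_sum => b _.
  apply: leq_sum => c _; apply: leq_sum => x _;
    case: (boolP (E a b c x)) => // Ex.
  by have -> : any4 K a b c x := any4_sym symE Ex (any_sparse_class a b c x).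
rewrite leq_mul2l /=.
have H1 : \sum_a \sum_b \sum_c \sum_x (rich a b && rich c x : nat)
    <= #|V| * (#|V| * (p * p)).
  apply: sum_all => a; apply: leq_trans (_ : \sum_b rich a b * (#|V| * p) <= _).
    apply: leq_sum => b _; case: (rich a b); last by rewrite big1 // => c _;
      rewrite big1.
    rewrite mul1n; apply: sum_all => c; exact: Pp.
  by rewrite -big_distrl mulnCA leq_mul // Pp.
have H2 : \sum_a \sum_b \sum_c \sum_(x : V) (rich a b && rich a c : nat)
    <= #|V| * (#|V| * (p * p)).
  apply: sum_all => a; apply: leq_trans (_ : \sum_b rich a b * (#|V| * p) <= _).
    apply: leq_sum => b _; case: (rich a b); last by rewrite big1 // => c _;
      rewrite big1.
    rewrite mul1n exchange_big; apply: sum_all => c; exact: Pp.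
  by rewrite -big_distrl mulnCA leq_mul // Pp.
have H3 : \sum_a \sum_b \sum_c \sum_x (heavy_link a b c && heavy_link a b x :
  nat)
    <= #|V| * (3 * heavy_star_size d * (hub_deg * hub_deg) + #|V| * (d * d)).
  by apply: sum_all => a; apply: heavy_link_cherries; case: (bl a).
have H4 : \sum_a \sum_b \sum_c \sum_x (heavy_link a b c && rich b x : nat)
    <= #|V| * ((2 * heavy_star_size d * hub_deg + #|V| * d) * p).
  apply: sum_all => a; apply: leq_trans (_ : (\sum_b \sum_c heavy_link a b c) *
    p <= _).
    rewrite big_distrl; apply: leq_sum => b _; rewrite big_distrl.
    apply: leq_sum => c _; case: (heavy_link a b c); last by rewrite big1.
    rewrite /= mul1n; exact: Pp.
  rewrite leq_mul2r; apply/orP; right.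
  by have [_ /heavy_link_sum + _] := bl a; rewrite cards0.
have H5 : \sum_a \sum_b \sum_c \sum_x (light rich a b c x : nat)
    <= #|V| * (3 * ((star2_size k d).+1 * d.+1) * pair_bound V k d t p
        + #|V| * (2 * star2_size k d * heavy_deg k d t + #|V| * k)).
  apply: sum_all => a; have [ba _ _] := bl a.
  by have := @light_sum V E k d t symE rich a set0 p ba (rich_sym k d t symE)
    Pp; rewrite cards0.
have H := leq_add (leq_add (leq_add (leq_add H1 H2) H3) H4) H5.
apply: leq_trans (leq_trans _ H) _; last first.
  have ring5 (m a b c e : nat) : m * a + m * a + m * b + m * c + m * e <=
    m * (2 * a + b + c + e) by lia.
  exact: ring5.
rewrite -!big_split; apply: leq_sum => a _.
rewrite -!big_split; apply: leq_sum => b _.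
rewrite -!big_split; apply: leq_sum => c _.
rewrite -!big_split; apply: leq_sum => x _ /=.
rewrite /K /light /sparse_class; case: (E a b c x) => //=.
case: (rich a b && rich c x) => //; case: (rich a b && rich a c) => //.
case: (heavy_link a b c && heavy_link a b x) => //;
  case: (heavy_link a b c && rich b x) => //.
Qed.

End Sparse.

(** * Sizes and budgets in terms of t, d and k *)

Lemma star3_size_le k : 0 < k -> star3_size k <= 2 * k. Proof. by rewrite
  /star3_size; lia. Qed.

Lemma star2_size_le k d : 0 < k -> 0 < d -> star2_size k d <= 3 * (d * k).
Proof. by rewrite /star2_size /star3_size; nia. Qed.

Lemma star1_size_le k d : 0 < k -> 0 < d -> star1_size k d <= 4 * (d * d * k).
Proof. by move=> k0 d0; have := star2_size_le k0 d0; rewrite /star1_size;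
  nia. Qed.

Lemma heavy_star_size_le d : 0 < d -> heavy_star_size d <= 3 * (d * d).
Proof. by rewrite /heavy_star_size /fan_size; nia. Qed.

Lemma heavy_deg_le k d t : 0 < k -> 0 < d -> 0 < t ->
  heavy_deg k d t <= 13 * (t * (d * d * k)).
Proof.
move=> k0 d0 t0; have ddk : d * d * k <= t * (d * d * k) by rewrite leq_pmull.
have dk : d * k <= d * d * k by rewrite -mulnA leq_pmull.
have kk : k <= d * k by rewrite leq_pmull.
have h1 := star1_size_le k0 d0; have h2 := star2_size_le k0 d0;
  have h3 := star3_size_le k0.
have : t * star1_size k d <= t * (4 * (d * d * k)) by rewrite leq_mul2l h1 orbT.
by rewrite /heavy_deg; lia.
Qed.

Lemma robust_budget_le k d t : 0 < k -> 0 < d -> 0 < t ->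
  robust_budget k d t <= 9 * (t * (d * d * k)).
Proof.
move=> k0 d0 t0; have ddk : d * d * k <= t * (d * d * k) by rewrite leq_pmull.
have h0 : 0 < d * d * k by rewrite !muln_gt0 d0.
have h1 := star1_size_le k0 d0.
have : t * star1_size k d <= t * (4 * (d * d * k)) by rewrite leq_mul2l h1 orbT.
by rewrite /robust_budget; lia.
Qed.

Lemma hub_deg_le d t : 0 < d -> 0 < t -> hub_deg d t <= 8 * (t * (d * d)).
Proof.
move=> d0 t0; have dd : d * d <= t * (d * d) by rewrite leq_pmull.
have d1 : d <= d * d by rewrite leq_pmull.
have h1 := heavy_star_size_le d0.
have : t * heavy_star_size d <= t * (3 * (d * d)) by rewrite leq_mul2l h1 orbT.
by rewrite /hub_deg /fan_size; lia.
Qed.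

(** * Edge bound for relations without a star *)

Section SingleStar.

Variables (V : finType) (E : V -> V -> V -> V -> bool) (k d : nat).
Hypotheses (symE : sym4 E) (k_gt0 : 0 < k) (d_gt0 : 0 < d).
Hypothesis kdn : k * (d * d * d) <= #|V|.

(** Here [t] is 1, and a vertex has at most [2 * d] rich pairs: [d] from hubs and [d] from robust
    pairs. The critical term is the cube of [X = d^2 k], and [X^3 = k (k d^3)^2 <= k n^2]. *)
Lemma no_star_sum : ~ (exists A, star1 E k d A) ->
  \sum_a \sum_b \sum_c \sum_x (E a b c x : nat) <=
    24 * (80 * 100 * (k * (#|V| * #|V| * #|V|))).
Proof.
move=> nS; have nS1 : ~ (exists A, pack (star1 E k d) 1 A).
  by case=> A [A1 [A2 [A1S _ _ _]]]; apply: nS; exists A1.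
have core Qf m : bounded m (node Qf d) -> completable E k d 1 (node Qf d) ->
    forall v, blocked d Qf v set0.
  move=> Qm cQ v; have [_ _ [Z]] := sparse_core Qm cQ nS1.
  rewrite leqn0 cards_eq0 => /eqP -> bl.
  by apply: bl; rewrite ?inE.
have b1 := core _ _ (@bounded_star1 V E k d) (@completable_star1 V E k d 1).
have bT := core _ _ (@bounded_heavy_star V E k d 1) (@completable_heavy_star V
  E k d 1).
have bP1 := core _ _ (@bounded_fan V d (hub E k d 1)) (@completable_hub_star V
  E k d 1).
have bP2 := core _ _ (@bounded_fan V d (robust_pair E k d 1))
  (@completable_robust_pair_star V E k d 1).
have Pp v : \sum_u (rich E k d 1 v u : nat) <= 2 * d.
  rewrite mul2n -addnn.
  apply: leq_trans (leq_add (blocked_fan (bP1 v)) (blocked_fan (bP2 v))).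
  rewrite -big_split; apply: leq_sum => u _ /=; rewrite inE !andbT.
  by rewrite /rich; case: (hub _ _ _ _ _ _); case: (robust_pair _ _ _ _ _ _).
apply: leq_trans (sum_sparse symE (fun v => And3 (b1 v) (bT v) (Pp v))) _.
rewrite leq_mul2l /=; move: kdn; set n := #|V| => kd_n.
rewrite (_ : 80 * 100 * (k * (n * n * n)) = n * (80 * 100 * (k * (n * n))));
  last by lia.
rewrite leq_mul2l; apply/orP; right.
have t_gt0 : 0 < 1 by [].
have hT := heavy_star_size_le d_gt0; have hq := hub_deg_le d_gt0 t_gt0.
have h2 := star2_size_le k_gt0 d_gt0; have h3 := star3_size_le k_gt0.
have hs := heavy_deg_le k_gt0 d_gt0 t_gt0;
  have hr := robust_budget_le k_gt0 d_gt0 t_gt0.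
rewrite !mul1n in hs hr hq.
have dn : d * d * d <= n by apply: leq_trans kd_n; rewrite leq_pmull.
have ddn : d * d <= n by apply: leq_trans dn; rewrite leq_pmulr.
have nnk : n * n <= k * (n * n) by rewrite leq_pmull.
have A1 : 2 * (n * (2 * d * (2 * d))) <= 8 * (n * n).
  by have := leq_mul (leqnn n) ddn; lia.
have A2 : 3 * heavy_star_size d * (hub_deg d 1 * hub_deg d 1) + n * (d * d) <=
  577 * (n * n).
  have := leq_mul hT (leq_mul hq hq); have := leq_mul dn dn.
  by have := leq_mul (leqnn n) ddn; lia.
have A3 : (2 * heavy_star_size d * hub_deg d 1 + n * d) * (2 * d) <= 98 * (n *
  n).
  have := leq_mul (leq_mul hT hq) (leqnn d); have := leq_mul dn ddn.
  by have := leq_mul (leqnn n) ddn; lia.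
set X := d * d * k in hs hr.
have dX : d * X <= n by apply: leq_trans kd_n; rewrite /X; lia.
have XX : X * X * X <= k * (n * n).
  by have := leq_mul (leqnn k) (leq_mul dX dX); rewrite /X; lia.
have Xn : X <= n by apply: leq_trans dX; rewrite leq_pmull.
have c2d : (star2_size k d).+1 * d.+1 <= 8 * X.
  have : (star2_size k d).+1 <= 4 * (d * k).
    by have : 0 < d * k; [rewrite muln_gt0 d_gt0|lia].
  have : d.+1 <= 2 * d by lia.
  by move=> h1 h1'; have := leq_mul h1' h1; rewrite /X; lia.
(* The constant 286 is twice 11 times 13, with 13 coming from [heavy_deg_le]. *)
have pb : pair_bound V k d 1 (2 * d) <= 286 * (X * X) + n * k + 2 * (n * d).
  rewrite /pair_bound -/n.
  have h : robust_budget k d 1 + d * star3_size k <= 11 * X.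
    have : d * k <= X by rewrite /X -mulnA leq_pmull.
    by have := leq_mul (leqnn d) h3; lia.
  by have := leq_mul h hs; lia.
have A4 : 3 * ((star2_size k d).+1 * d.+1) * pair_bound V k d 1 (2 * d)
    + n * (2 * star2_size k d * heavy_deg k d 1 + n * k) <= 72 * 100 * (k * (n
      * n)).
  have g1 := leq_mul c2d pb; have g2 := leq_mul (leqnn n) (leq_mul h2 hs).
  have g3 := leq_mul (leqnn (n * k)) dX; have g4 := leq_mul (leqnn (n * k)) Xn.
  have g5 : X * (n * d) <= k * (n * n).
    by have := leq_mul (leqnn n) dX; lia.
  have g6 : (star2_size k d).+1 * d.+1 * pair_bound V k d 1 (2 * d) <= 2312 *
    (k * (n * n)).
    by apply: leq_trans g1 _; clear -XX g4 g5; lia.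
  have g7 : n * (star2_size k d * heavy_deg k d 1) <= 39 * (k * (n * n)).
    by apply: leq_trans g2 _; clear -g3; lia.
  rewrite -[3 * _ * _]mulnA -[2 * _ * _]mulnA mulnDr [n * (2 * _)]mulnCA.
  move: g6 g7; move: (_ * pair_bound _ _ _ _ _) (n * (star2_size k d * _)) => y
    z g6 g7.
  by clear -g6 g7; lia.
by lia.
Qed.

End SingleStar.

(** * From one star to many disjoint stars *)

Section Restriction.

Variables (V : finType) (E : V -> V -> V -> V -> bool) (S : {set V}).

(** The type [V] is kept, so [#|V|] and its relation to [k] and [d] do not change. *)
Definition avoiding a b c x :=
  E a b c x && [&& a \notin S, b \notin S, c \notin S & x \notin S].

Lemma sym_avoiding : sym4 E -> sym4 avoiding.
Proof.
case=> h12 h23 h34; split=> a b c x; rewrite /avoiding.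
- by rewrite h12; congr (_ && _); rewrite andbCA.
- by rewrite h23; congr (_ && (_ && _)); rewrite andbCA.
- by rewrite h34; congr (_ && (_ && (_ && _))); rewrite andbC.
Qed.

(** [C] carries the fact that the enclosing centers avoid [S] from the leaves upwards; it can only
    be read off a nonempty packing, hence [0 < n]. *)
Lemma pack_restrict (Q Q' : {set V} -> Prop) (C : Prop) n A :
  (forall B, Q B -> [/\ Q' B, [disjoint B & S] & C]) -> 0 < n ->
  pack Q n A -> [/\ pack Q' n A, [disjoint A & S] & C].
Proof.
move=> QQ; case: n => // n _; elim: n A => [|n IH] A.
  case=> A1 [A2 [/QQ[Q1 A1S c] /= -> _ ->]]; split=> //; last by rewrite setU0.
  by exists A1, set0; split=> //; rewrite -setI_eq0 setI0.
case=> A1 [A2 [/QQ[Q1 A1S c] /IH[p2 A2S _] A12 ->]]; split=> //.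
  by exists A1, A2.
by rewrite disjointUl A1S.
Qed.

Lemma node_restrict (Qf Qf' : V -> {set V} -> Prop) (C : Prop) n A :
  (forall x B, Qf x B -> [/\ Qf' x B, [disjoint B & S] & x \notin S /\ C]) ->
  0 < n -> node Qf n A -> [/\ node Qf' n A, [disjoint A & S] & C].
Proof.
move=> QQ n0 [x [B [/(pack_restrict (QQ x) n0)[pB BS [xS c]] xB ->]]].
by split=> //; [exists x, B | rewrite disjointUl disjoints1 xS].
Qed.

Lemma star1_avoiding k d A : 0 < k -> 0 < d ->
  star1 avoiding k d A -> star1 E k d A /\ [disjoint A & S].
Proof.
move=> k0 d0 st; suff [] : [/\ star1 E k d A, [disjoint A & S] & True] by [].
apply: node_restrict st => // v B; apply: node_restrict => // u D.
apply: node_restrict => // w F [x /andP[Ex /and4P[vS uS wS xS]] ->].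
by split; rewrite ?disjoints1 //; exists x.
Qed.

End Restriction.

(** * Edges at one vertex *)

Section Center.

Variables (V : finType) (E : V -> V -> V -> V -> bool) (k d t : nat).
Hypothesis symE : sym4 E.
Local Notation rich := (rich E k d t).
Local Notation heavy_link := (heavy_link E k d t).
Local Notation light := (light E k d t (fun _ _ => false)).

(** An edge at [v] avoiding [Z] has a rich pair at [v], or else a heavy triple at [v], or else is
    light. The factor 6 counts the orders of its other vertices. *)
Lemma sum_center v (Z : {set V}) p tau phi :
  \sum_u (rich v u && (u \notin Z) : nat) <= p ->
  \sum_u \sum_w (heavy_link v u w && (u \notin Z) && (w \notin Z) : nat) <= tau
    ->
  \sum_u \sum_w \sum_x (light v u w x : nat) <= phi ->
  \sum_u \sum_w \sum_x
    (E v u w x && [&& u \notin Z, w \notin Z & x \notin Z] : nat) <=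
  6 * (p * (#|V| * #|V|) + tau * #|V| + phi).
Proof.
move=> Hp Ht Hf.
pose K u w x := [|| rich v u && (u \notin Z), heavy_link v u w && (u \notin Z)
  && (w \notin Z)
  | light v u w x].
apply: leq_trans (_ : 6 * \sum_u \sum_w \sum_x (K u w x : nat) <= _).
  apply: leq_trans (sum_any3 K); apply: leq_sum => u _; apply: leq_sum => w _.
  apply: leq_sum => x _.
  case: (boolP (E v u w x)) => //= Ex.
  have heavy23 a b c : heavy E k d t a b c = heavy E k d t a c b by rewrite
    (heavy23 _ _ _ symE).
  case: symE => _ E23 E34; rewrite /any3 /any2 /K /light /heavy_link.
  rewrite Ex -[E v u x w]E34 Ex (heavy23 v x u) (heavy23 v w u) (heavy23 v x w).
  case: (u \notin Z) => //; case: (w \notin Z) => //; case: (x \notin Z) => //=.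
  case: (rich v u) => //=; case: (rich v w) => //=; case: (rich v x) => //=;
    rewrite ?orbT //.
  by case: (heavy E k d t v u w); case: (heavy E k d t v u x);
    case: (heavy E k d t v w x); rewrite ?orbT.
rewrite leq_mul2l /=.
have H1 : \sum_u \sum_(w : V) \sum_(x : V) (rich v u && (u \notin Z) : nat)
    <= p * (#|V| * #|V|).
  apply: leq_trans (leq_mul Hp (leqnn _)); rewrite big_distrl /=.
  apply: leq_sum => u _; rewrite mulnCA; apply: sum_all => w.
  by rewrite mulnC; apply: sum_all.
have H2 : \sum_u \sum_w \sum_(x : V) (heavy_link v u w && (u \notin Z) && (w
  \notin Z) : nat)
    <= tau * #|V|.
  apply: leq_trans (leq_mul Ht (leqnn _)); rewrite big_distrl /=.
  apply: leq_sum => u _; rewrite big_distrl; apply: leq_sum => w _.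
  by rewrite /= mulnC; apply: sum_all.
apply: leq_trans (leq_add (leq_add H1 H2) Hf).
rewrite -!big_split; apply: leq_sum => u _.
rewrite -!big_split; apply: leq_sum => w _.
rewrite -!big_split; apply: leq_sum => x _; rewrite /K /=.
by case: (rich v u && _) => //; case: (heavy_link v u w && _ && _).
Qed.

End Center.

(** * Degree bounds without t disjoint stars *)

Section ManyStars.

Variables (V : finType) (E : V -> V -> V -> V -> bool) (k d t : nat).
Hypotheses (symE : sym4 E) (k_gt0 : 0 < k) (d_gt0 : 0 < d) (t_gt0 : 0 < t).
Hypothesis no_stars : ~ (exists A, pack (star1 E k d) t A).
Local Notation n := #|V|.

Definition light_bound :=
  3 * (t * star1_size k d + (star2_size k d).+1 * d.+1) * pair_bound V k d t 0
  + n * (2 * star2_size k d * heavy_deg k d t + n * k).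
(** Only private blocking sets are used, and their sizes appear with a factor [t]. *)
Definition coarse_degree :=
  6 * (2 * (t * fan_size d + d) * (n * n) + (2 * (t * heavy_star_size d +
    heavy_star_size d) * hub_deg d t + n * d) * n
       + light_bound).
(** With the common blocking set deleted, the private sets for rich pairs and heavy triples
    disappear; the light part still uses the private set for full stars. *)
Definition fine_degree :=
  6 * (2 * d * (n * n) + (2 * heavy_star_size d * hub_deg d t + n * d) * n +
    light_bound).

(** [X] collects the robust centers for full stars and for the three kinds of partial stars, [Z] the
    common blocking sets of the partial stars, and [S] comes from a maximal family of full stars. *)
Lemma degree_bounds : exists X Z S : {set V},
  [/\ #|X| <= 4 * t, #|Z| <= 3 * t * heavy_star_size d, #|S| <= t * star1_size
    k d,
      forall A, star1 E k d A -> ~~ [disjoint A & S]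
    & forall v, v \notin X ->
      \sum_u \sum_w \sum_x (E v u w x : nat) <= coarse_degree /\
      (v \notin Z -> \sum_u \sum_w \sum_x
         (E v u w x && [&& u \notin Z, w \notin Z & x \notin Z] : nat)
           <= fine_degree)].
Proof.
have [X1t bX1 _] := sparse_core (@bounded_star1 V E k d)
  (@completable_star1 V E k d t) no_stars.
have [XTt bXT [ZT ZTc bZT]] := sparse_core (@bounded_heavy_star V E k d t)
  (@completable_heavy_star V E k d t) no_stars.
have [XPt bXP [ZP ZPc bZP]] := sparse_core (@bounded_fan V d (hub E k d t))
  (@completable_hub_star V E k d t) no_stars.
have [XRt bXR [ZR ZRc bZR]] := sparse_core (@bounded_fan V d (robust_pair E k d
  t))
  (@completable_robust_pair_star V E k d t) no_stars.
set X1 := robust _ _ _ in X1t bX1; set XT := robust _ _ _ in XTt bXT.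
set XP := robust _ _ _ in XPt bXP; set XR := robust _ _ _ in XRt bXR.
have [[A pA]|[S Sc nS]] := pack_or_block t set0 (@bounded_star1 V E k d).
  by case: no_stars; exists A.
pose Z := ZT :|: ZP :|: ZR.
exists (X1 :|: XT :|: XP :|: XR), Z, S; split.
- by rewrite !cardsU; move: X1t XTt XPt XRt; clear; lia.
- have cPT : fan_size d <= heavy_star_size d by rewrite /heavy_star_size
  /fan_size; nia.
  have tt : t.-1 <= t := leq_pred t.
  have := leq_mul tt cPT; have := leq_mul tt (leqnn (heavy_star_size d)).
  have := leq_mul (leqnn t.-1) cPT.
  by rewrite !cardsU; move: ZTc ZPc ZRc; clear; lia.
- by rewrite (leq_trans Sc) // leq_mul2r leq_pred orbT.
- by move=> A /nS; rewrite set0U.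
move=> v vX; move: (vX); rewrite 3!in_setU !negb_or -!andbA.
case/and4P=> vX1 vXT vXP vXR.
have [W1 W1c b1] := bX1 v vX1; have [WT WTc bT] := bXT v vXT.
have [WP WPc bP] := bXP v vXP; have [WR WRc bR] := bXR v vXR.
have Hlight : \sum_u \sum_w \sum_x (light E k d t (fun _ _ => false) v u w x :
  nat)
    <= light_bound.
  have H0 : forall a : V, \sum_(b : V) (false : nat) <= 0 by move=> a;
    rewrite big1.
  have := @light_sum V E k d t symE (fun _ _ => false) v W1 0 b1 (fun _ _ =>
    erefl) H0.
  move=> h; apply: (leq_trans h).
  by rewrite leq_add2r leq_mul2r leq_mul2l leq_add2r W1c !orbT.
split=> [|vZ].
  have H2 : \sum_u \sum_w (heavy_link E k d t v u w && (u \notin set0) && (w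
    \notin set0) : nat)
     <= 2 * (t * heavy_star_size d + heavy_star_size d) * hub_deg d t + n * d.
    apply: leq_trans (_ : 2 * (#|WT| + heavy_star_size d) * hub_deg d t + n * d
      <= _); last first.
      by rewrite leq_add2r leq_mul2r leq_mul2l leq_add2r WTc !orbT.
    apply: leq_trans (heavy_link_sum symE bT); apply: leq_sum => u _;
      apply: leq_sum => w _.
    by rewrite !inE !andbT.
  have H1 : \sum_u (rich E k d t v u && (u \notin set0) : nat) <= 2 * (t *
    fan_size d + d).
    apply: leq_trans (_ : \sum_u (hub E k d t v u : nat) + \sum_u (robust_pair
      E k d t v u : nat) <= _).
      rewrite -big_split; apply: leq_sum => u _; rewrite inE andbT /rich /=.
      by case: (hub _ _ _ _ _ _); case: (robust_pair _ _ _ _ _ _).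
    have h1 := leq_trans (sum_notin _ _) (leq_add WPc (blocked_fan bP)).
    have h2 := leq_trans (sum_notin _ _) (leq_add WRc (blocked_fan bR)).
    by rewrite mul2n -addnn leq_add.
  apply: leq_trans (sum_center symE H1 H2 Hlight).
  apply: leq_sum => u _; apply: leq_sum => w _; apply: leq_sum => x _.
  by rewrite !inE !andbT.
have bTZ : blocked d (heavy_star2 E k d t) v Z.
  by apply: bZT => //; rewrite /Z -setUA subsetUl.
have bPZ : blocked d (fun v => sing (hub E k d t v)) v Z.
  by apply: bZP => //; rewrite /Z setUAC subsetUr.
have bRZ : blocked d (fun v => sing (robust_pair E k d t v)) v Z.
  by apply: bZR => //; rewrite /Z subsetUr.
have H1 : \sum_u (rich E k d t v u && (u \notin Z) : nat) <= 2 * d.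
  rewrite mul2n -addnn.
  apply: leq_trans (leq_add (blocked_fan bPZ) (blocked_fan bRZ)).
  rewrite -big_split; apply: leq_sum => u _; rewrite /rich /=.
  by case: (hub _ _ _ _ _ _); case: (robust_pair _ _ _ _ _ _);
    case: (u \notin Z).
have h := sum_center symE H1 (heavy_link_sum_avoiding symE bTZ) Hlight.
exact: leq_trans h (leqnn _).
Qed.

End ManyStars.

(** * Edge bound without t disjoint stars *)

Section Counting.

Variables (V : finType) (E : V -> V -> V -> V -> bool) (k d t : nat).
Hypotheses (symE : sym4 E) (k_gt0 : 0 < k) (d_gt0 : 0 < d) (t_gt0 : 0 < t).
Local Notation n := #|V|.

(** No star avoids [S], so the single star bound covers the edges missing [S]. Any other edge is
    charged to a vertex in [X] if possible, then to one in [Z], and finally to one in [S] with the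
    whole edge outside [Z]. *)
Lemma no_stars_sum_raw : k * (d * d * d) <= n ->
  ~ (exists A, pack (star1 E k d) t A) ->
  \sum_a \sum_b \sum_c \sum_x (E a b c x : nat) <=
    24 * (80 * 100 * (k * (n * n * n))) +
    24 * (4 * t * (n * n * n) + 3 * t * heavy_star_size d * coarse_degree V k d
      t
          + t * star1_size k d * fine_degree V k d t).
Proof.
move=> kdn nS.
have [X [Z [S [Xc Zc Sc blS deg]]]] := degree_bounds symE k_gt0 d_gt0 t_gt0 nS.
have nE : ~ (exists A, star1 (avoiding E S) k d A).
  case=> A /(star1_avoiding k_gt0 d_gt0)[/blS] + AS.
  by rewrite AS.
have := no_star_sum (sym_avoiding S symE) k_gt0 d_gt0 kdn nE.
pose cond v u w x := [|| v \in X, (v \notin X) && (v \in Z)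
  | [&& v \notin X, v \notin Z, v \in S, u \notin Z, w \notin Z & x \notin Z]].
pose K v u w x := E v u w x && cond v u w x.
have HK : \sum_a \sum_b \sum_c \sum_x (any4 K a b c x : nat) <=
    24 * (4 * t * (n * n * n) + 3 * t * heavy_star_size d * coarse_degree V k d
      t
          + t * star1_size k d * fine_degree V k d t).
  apply: leq_trans (sum_any4 K) _; rewrite leq_mul2l /=.
  have Hv v : \sum_b \sum_c \sum_x (K v b c x : nat) <=
      (v \in X) * (n * n * n) + (v \in Z) * coarse_degree V k d t
      + (v \in S) * fine_degree V k d t.
    rewrite /K /cond; case: (boolP (v \in X)) => [vX|/deg[crude fine]] /=.
      rewrite -addnA mul1n (leq_trans _ (leq_addr _ _)) // -mulnA.
      apply: sum_all => u; apply: sum_all => w; rewrite -[n]muln1.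
      by apply: sum_all => x; apply: leq_b1.
    rewrite mul0n add0n; case: (boolP (v \in Z)) => [vZ|/fine{}fine] /=.
      rewrite mul1n (leq_trans _ (leq_addr _ _)) // (leq_trans _ crude) //.
      apply: leq_sum => u _; apply: leq_sum => w _; apply: leq_sum => x _.
      by rewrite andbT.
    rewrite mul0n add0n; case: (v \in S); last first.
      by rewrite big1 // => u _; rewrite big1 // => w _; rewrite big1 // => x _;
        rewrite andbF.
    by rewrite mul1n.
  apply: leq_trans (leq_sum _ (fun v _ => Hv v)) _; rewrite !big_split /=.
  apply: leq_add; first apply: leq_add.
  - by apply: leq_trans (sum_in X (fun _ => leqnn _)) _;
    rewrite leq_mul2r Xc orbT.
  - by apply: leq_trans (sum_in Z (fun _ => leqnn _)) _;
    rewrite leq_mul2r Zc orbT.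
  - by apply: leq_trans (sum_in S (fun _ => leqnn _)) _;
    rewrite leq_mul2r Sc orbT.
move=> HE; apply: leq_trans (leq_add HE HK).
rewrite -big_split; apply: leq_sum => a _; rewrite -big_split;
  apply: leq_sum => b _.
rewrite -big_split; apply: leq_sum => c _; rewrite -big_split;
  apply: leq_sum => x _.
rewrite /=; case: (boolP (E a b c x)) => // Ex.
suff : avoiding E S a b c x || any4 cond a b c x.
  by case/orP=> [->//|/(any4_sym symE Ex)]; rewrite -/K => ->; rewrite leq_addl.
rewrite /avoiding Ex /any4 /any3 /any2 /cond.
case: (a \in X) => //; case: (b \in X); rewrite ?orbT //.
case: (c \in X); rewrite ?orbT //; case: (x \in X); rewrite ?orbT //.
case: (a \in Z) => //; case: (b \in Z); rewrite ?orbT //.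
case: (c \in Z); rewrite ?orbT //; case: (x \in Z); rewrite ?orbT //.
by case: (a \in S); case: (b \in S); case: (c \in S); case: (x \in S).
Qed.

(** The critical term is [Y^4] for [Y = t d^2 k], with one factor each from [S], the private
    blocking set, [robust_budget] and [heavy_deg]. Since [t^4 <= d], it is at most
    [k (k d^3)^3 <= k n^3]. *)
Lemma no_stars_sum : k * (d * d * d) <= n -> t <= k -> t * t * t * t <= d ->
  ~ (exists A, pack (star1 E k d) t A) ->
  \sum_a \sum_b \sum_c \sum_x (E a b c x : nat) <=
    24 * (90 * 100 * 100 * (k * (n * n * n))).
Proof.
move=> kdn tk tttt nS; apply: leq_trans (no_stars_sum_raw kdn nS) _.
rewrite -mulnDr leq_mul2l /=.
have hT := heavy_star_size_le d_gt0; have hq := hub_deg_le d_gt0 t_gt0.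
have h1 := star1_size_le k_gt0 d_gt0; have h2 := star2_size_le k_gt0 d_gt0.
have h3 := star3_size_le k_gt0; have hs := heavy_deg_le k_gt0 d_gt0 t_gt0.
have hr := robust_budget_le k_gt0 d_gt0 t_gt0.
move: kdn nS => + _; rewrite /coarse_degree /fine_degree /light_bound
  /pair_bound.
rewrite [#|V|]lock; move: (locked _) => m kdm; rewrite muln0 addn0.
pose Y := t * (d * d * k); rewrite -/Y in hs hr.
have td : t <= d.
  by apply: leq_trans tttt; rewrite leq_pmull // !muln_gt0 t_gt0.
have ttd : t * t <= d.
  by apply: leq_trans tttt;
    rewrite -[t * t * t * t]mulnA leq_pmulr // muln_gt0 t_gt0.
have tt_le : t * t <= k * k by apply: leq_mul.
have ttt_le : t * t * t <= k * k * k by apply: leq_mul.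
have mm : k * (d * d * d) * (k * (d * d * d)) <= m * m by apply: leq_mul.
have Ym : Y <= m.
  by have := leq_mul td (leqnn (d * d * k)); rewrite /Y; clear -kdm; lia.
have Y4 : Y * Y * Y * Y <= k * (m * m * m).
  have := leq_mul tttt (leqnn (d * d * k * (d * d * k) * (d * d * k) * (d * d *
    k))).
  by have := leq_mul (leqnn k) (leq_mul mm kdm); rewrite /Y; clear; lia.
have dYY : d * (Y * Y) <= m * m.
  have := leq_mul ttd (leqnn (d * (d * d * k) * (d * d * k))).
  by rewrite /Y; clear -mm; lia.
have Yd : Y * d <= k * m by have := leq_mul tk kdm; rewrite /Y; clear; lia.
(* [L] is an upper bound for [light_bound]; 12 is 4 from [tc1] plus 8 from [c2d]. *)
pose L := 3 * (12 * Y) * (286 * (Y * Y) + m * k)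
    + m * (2 * (3 * (d * k)) * (13 * Y) + m * k).
have YL : Y * L <= 110 * 100 * (k * (m * m * m)).
  have g1 : Y * Y * (m * k) <= k * (m * m * m).
    by have := leq_mul (leq_mul Ym Ym) (leqnn (m * k)); clear; lia.
  have g2 : m * (d * k) * (Y * Y) <= k * (m * m * m).
    by have := leq_mul (leqnn (m * k)) dYY; clear; lia.
  have g3 : Y * (m * m * k) <= k * (m * m * m).
    by have := leq_mul Ym (leqnn (m * m * k)); clear; lia.
  by rewrite /L; clear -Y4 g1 g2 g3; lia.
have c2d : (star2_size k d).+1 * d.+1 <= 8 * Y.
  have e1 : (star2_size k d).+1 <= 4 * (d * k).
    by have : 0 < d * k; [rewrite muln_gt0 d_gt0|lia].
  have e2 : d.+1 <= 2 * d by lia.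
  have : d * d * k <= Y by rewrite leq_pmull.
  by have := leq_mul e1 e2; clear; lia.
have tc1 : t * star1_size k d <= 4 * Y.
  by have := leq_mul (leqnn t) h1; rewrite /Y; clear; lia.
have Lle : 3 * (t * star1_size k d + (star2_size k d).+1 * d.+1)
      * (2 * (robust_budget k d t + d * star3_size k) * heavy_deg k d t + m * k)
    + m * (2 * star2_size k d * heavy_deg k d t + m * k) <= L.
  rewrite /L leq_add //.
    rewrite leq_mul // ?leq_mul2l /=; first by clear -tc1 c2d; lia.
    rewrite leq_add2r.
    have e1 : robust_budget k d t + d * star3_size k <= 11 * Y.
      have : d * d * k <= Y by rewrite leq_pmull.
      have : d * k <= d * d * k by rewrite -mulnA leq_pmull.
      by have := leq_mul (leqnn d) h3; clear -hr; lia.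
    by have := leq_mul e1 hs; clear; lia.
  by rewrite leq_mul2l leq_add2r leq_mul ?orbT // leq_mul2l h2.
move: Lle; set L0 := (X in X <= L) => Lle.
have tdd : t * (d * d) <= Y by rewrite /Y leq_mul2l leq_pmulr ?orbT.
have tcT : t * heavy_star_size d <= 3 * (t * (d * d)).
  by have := leq_mul (leqnn t) hT; clear; lia.
have coarse : 3 * t * heavy_star_size d * (6 * (2 * (t * fan_size d + d) * (m *
  m)
      + (2 * (t * heavy_star_size d + heavy_star_size d) * hub_deg d t + m * d)
        * m + L0))
    <= 9 * (t * (d * d)) * (6 * (6 * (t * d) * (m * m)
      + (2 * (6 * (t * (d * d))) * (8 * (t * (d * d))) + m * d) * m + L)).
  rewrite -(mulnA 3) leq_mul //; first by clear -tcT; lia.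
  rewrite leq_mul2l /= leq_add // leq_add //.
    have e : d <= t * d by rewrite leq_pmull.
    rewrite leq_mul2r; apply/orP; right; rewrite /fan_size.
    by have := leq_mul (leqnn t) d_gt0; clear -e; lia.
  rewrite leq_mul2r leq_add2r leq_mul ?orbT // leq_mul2l /=.
  by have e : d * d <= t * (d * d); [rewrite leq_pmull|clear -e tcT hT; lia].
have fine : t * star1_size k d * (6 * (2 * d * (m * m)
      + (2 * heavy_star_size d * hub_deg d t + m * d) * m + L0))
    <= 4 * Y * (6 * (2 * d * (m * m)
      + (2 * (3 * (d * d)) * (8 * (t * (d * d))) + m * d) * m + L)).
  rewrite leq_mul // leq_mul2l /= leq_add // leq_add2l leq_mul2r leq_add2r.
  by rewrite leq_mul ?orbT // leq_mul2l.
have g1 : t * (d * d) * (t * d * (m * m)) <= k * (m * m * m).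
  have := leq_mul (leq_mul tt_le (leqnn (d * d * d))) (leqnn (m * m)).
  by have := leq_mul (leqnn (k * m * m)) kdm; clear; lia.
have g2 : t * (d * d) * (t * (d * d) * (t * (d * d)) * m) <= k * (m * m * m).
  have := leq_mul ttt_le (leqnn (d * d * d * (d * d * d) * m)).
  by have := leq_mul (leqnn (k * m)) mm; clear; lia.
have g3 : t * (d * d) * (m * d * m) <= k * (m * m * m).
  have := leq_mul tk (leqnn (d * d * d * (m * m))).
  have : m * m * m <= k * (m * m * m) by rewrite leq_pmull.
  by have := leq_mul (leqnn (m * m)) kdm; clear; lia.
have g4 : t * (d * d) * L <= 110 * 100 * (k * (m * m * m)).
  by apply: leq_trans YL; rewrite leq_mul2r tdd orbT.
have g5 : Y * (d * (m * m)) <= k * (m * m * m).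
  by have := leq_mul Yd (leqnn (m * m)); clear; lia.
have g6 : Y * (d * d * (t * (d * d)) * m) <= k * (m * m * m).
  have := leq_mul tt_le (leqnn (d * d * d * (d * d * d) * k * m)).
  by have := leq_mul (leqnn (k * m)) mm; rewrite /Y; clear; lia.
have g7 : t * (m * m * m) <= k * (m * m * m) by rewrite leq_mul2r tk orbT.
apply: leq_trans (_ : 80 * 100 * (k * (m * m * m)) + (4 * t * (m * m * m) +
  9 * (t * (d * d)) * (6 * (6 * (t * d) * (m * m)
      + (2 * (6 * (t * (d * d))) * (8 * (t * (d * d))) + m * d) * m + L)) +
  4 * Y * (6 * (2 * d * (m * m)
      + (2 * (3 * (d * d)) * (8 * (t * (d * d))) + m * d) * m + L))) <= _).
  by rewrite leq_add2l leq_add // leq_add2l.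
by clearbody L; clearbody Y; clear -g1 g2 g3 g4 YL g5 g6 g7; lia.
Qed.

End Counting.

(** * Copies of generalised stars *)

Section Copies.

Variable V : finType.
Implicit Types (A B : {set V}) (Q : {set V} -> Prop) (K : {set V} -> bool).

Lemma pack_mono Q Q' n A :
  (forall B, Q B -> Q' B) -> pack Q n A -> pack Q' n A.
Proof.
move=> QQ; elim: n A => [|n IH] A //= [A1 [A2 [/QQ q1 /IH p2 A12 ->]]].
by exists A1, A2.
Qed.

Lemma pack_family Q n A : pack Q n A ->
  exists f : 'I_n -> {set V}, [/\ forall i, Q (f i), forall i, f i \subset A
    & forall i j, i != j -> [disjoint f i & f j]].
Proof.
elim: n A => [|n IH] A /=; first by move=> _; exists (fun=> set0); split=> -[].
case=> A1 [A2 [Q1 /IH[f [Qf fA fd]] A12 ->]].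
exists (fun i => if unlift ord0 i is Some j then f j else A1);
  split=> [i|i|i j].
- by case: unliftP.
- case: unliftP => [j _|_]; last exact: subsetUl.
  by rewrite (fintype.subset_trans (fA j)) // subsetUr.
- case: unliftP => [i' ->|->]; case: unliftP => [j' ->|->] //.
  + by rewrite (inj_eq lift_inj); apply: fd.
  + by move=> _; rewrite disjoint_sym; apply: disjointWr A12.
  + by move=> _; apply: disjointWr A12.
Qed.

(** [K] is a predicate on images of edges, so that passing to a branch can replace it by
    [K (v |: e)]. *)
Definition embeds (ds : seq nat) K A : Prop :=
  exists g : star_vertex ds -> V, [/\ injective g, forall y, g y \in A
    & {in star_edge ds, forall e : {set star_vertex ds}, K (g @: e)}].

Lemma embeds_sing (R : V -> bool) K A : (forall x, R x -> K [set x]) ->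
  sing R A -> embeds [::] K A.
Proof.
move=> RK [x Rx ->]; exists (fun=> x); split=> [[] [] //|y|e].
  by rewrite inE.
by rewrite inE => /eqP ->; rewrite imset_set1; apply: RK.
Qed.

(** The branch embeddings are glued at [v]; injectivity holds because the branches are disjoint and
    [v] lies outside them. *)
Lemma embeds_node Qf d ds K A :
  (forall v B, Qf v B -> embeds ds (fun e => K (v |: e)) B) ->
  node Qf d A -> embeds (d :: ds) K A.
Proof.
move=> QK [v [B [/(pack_mono (QK v))/pack_family[f [Qf' fB fd]] vB ->]]].
have [g Hg] := choice Qf'.
pose h (y : star_vertex (d :: ds)) := if y is Some (i, x) then g i x else v.
have gB i x : g i x \in B by have [_ gf _] := Hg i;
  apply: (fintype.subsetP (fB i)).
exists h; split.
- move=> [[i x]|] [[j y]|] //= => [gij|giv|gjv]; first last.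
  + by rewrite gjv gB in vB.
  + by rewrite -giv gB in vB.
  have [ij|ij] := eqVneq i j.
    rewrite -ij in gij *; congr (Some (_, _)).
    by have [gi _ _] := Hg i; apply: gi.
  have [[_ gf _] [_ gf' _]] := (Hg i, Hg j).
  by have := disjointFr (fd i j ij) (gf x); rewrite gij gf'.
- by case=> [[i x]|]; rewrite !inE ?eqxx //= gB orbT.
move=> e /imset2P[i e' _ e'E ->].
rewrite imsetU1 -imset_comp; have [_ _ gK] := Hg i.
exact: gK.
Qed.

End Copies.

(** * From a 4-graph to a symmetric relation and back *)

Section Hypergraph.

Variable G : uhypergraph 4.

(** Since edges have four elements, this forces the four vertices to be distinct. *)
Definition tetrad (a b c x : G) : bool :=
  (a |: (b |: (c |: [set x]))) \in edge G.

Lemma sym_tetrad : sym4 tetrad.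
Proof.
split=> a b c x; rewrite /tetrad; first by rewrite setUCA.
  by rewrite (setUCA [set b]).
by rewrite (setUC [set c]).
Qed.

Lemma card_edge_le :
  #|edge G| <= \sum_a \sum_b \sum_c \sum_x (tetrad a b c x : nat).
Proof.
pose D := [set z : G * G * G * G | tetrad z.1.1.1 z.1.1.2 z.1.2 z.2].
have -> : \sum_a \sum_b \sum_c \sum_x (tetrad a b c x : nat) = #|D|.
  rewrite -sum_boolE pair_bigA pair_bigA pair_bigA /=.
  by [].
pose h (z : G * G * G * G) := z.1.1.1 |: (z.1.1.2 |: (z.1.2 |: [set z.2])).
apply: leq_trans (leq_imset_card h D).
apply/subset_leq_card/fintype.subsetP => e eG.
have := edge_card eG; rewrite cardE.
case def_e: (enum e) => [|a [|b [|c [|x []]]]] // _.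
have ee : e = h (a, b, c, x).
  by apply/setP=> y; rewrite -mem_enum def_e !inE.
by apply/imsetP; exists (a, b, c, x);
  rewrite // inE /tetrad -/(h (a, b, c, x)) -ee.
Qed.

Lemma star1_copies k d t A : pack (star1 tetrad k d) t A ->
  has_disjoint_copies t (star [:: d; d; k]) G.
Proof.
case/pack_family=> f [Sf _ fd].
have Ef i : embeds [:: d; d; k] (mem (edge G)) (f i).
  apply: embeds_node (Sf i) => v B; apply: embeds_node => u C.
  by apply: embeds_node => w D; apply: embeds_sing.
have [g Hg] := choice Ef.
exists g; split=> [i|i j ij]; first by have [gi _ gE] := Hg i.
have sub l : codom (g l) \subset f l.
  by apply/fintype.subsetP => _ /codomP[y ->]; have [_ + _] := Hg l.
exact: disjointW (sub i) (sub j) (fd i j ij).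
Qed.

End Hypergraph.

(** * Real parameters and rounding *)

Import Order.TTheory GRing.Theory Num.Theory.
Local Open Scope ring_scope.

Lemma truncn_root_le (R : realType) (x : R) (m : nat) : 0 <= x -> (0 < m)%N ->
  (Num.truncn (x `^ m%:R^-1))%:R ^+ m <= x.
Proof.
move=> x0 m0; have y0 : 0 <= x `^ m%:R^-1 by apply: powR_ge0.
apply: le_trans (_ : (x `^ m%:R^-1) ^+ m <= _).
  by rewrite lerXn2r ?nnegrE // truncn_le.
by rewrite -powR_mulrn // -powRrM mulVf ?powRr1 // pnatr_eq0 -lt0n.
Qed.

Theorem theorem5p7 (R : realType) :
  exists C : R, forall (k n : nat), (0 < k)%N -> (k <= n)%N ->
  forall G : uhypergraph 4, #|G| = n ->
  C * k%:R * n%:R ^+ 3 <= #|edge G|%:R ->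
  let d : nat := Num.truncn ((n%:R / k%:R : R) `^ 3^-1) in
  let t : nat := Num.truncn (Num.min (k%:R : R) (d%:R `^ 4^-1)) in
  has_disjoint_copies t (star [:: d; d; k]) G.
Proof.
(* One more than the constant of [no_stars_sum]: as [k n^3] is positive, the two bounds then
   contradict each other. *)
exists (24 * (90 * 100 * 100)).+1%:R => k n k0 kn G Gn eG d t.
have kR : 0 < k%:R :> R by rewrite ltr0n.
(* From [k <= n] the quotient is at least 1, so rounding down leaves [d] positive. *)
have d0 : (0 < d)%N.
  rewrite truncn_gt0 [leLHS](_ : _ = 1 `^ 3^-1); last by rewrite powR1.
  apply: ge0_ler_powR; rewrite ?nnegrE ?invr_ge0 ?divr_ge0 ?ler0n //.
  by rewrite ler_pdivlMr // mul1r ler_nat.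
have kdn : (k * (d * d * d) <= n)%N.
  rewrite -(ler_nat R) natrM mulrC -ler_pdivlMr //.
  have := @truncn_root_le R (n%:R / k%:R) 3 (divr_ge0 (ler0n _ _) (ler0n _ _))
    isT.
  by rewrite -/d -natrX !expnS expn0 muln1 mulnA.
have tmin : t%:R <= Num.min (k%:R : R) (d%:R `^ 4^-1).
  by rewrite truncn_le // le_min ler0n powR_ge0.
have tk : (t <= k)%N.
  by rewrite -(ler_nat R); apply: le_trans tmin _; rewrite ge_min lexx.
have tttt : (t * t * t * t <= d)%N.
  have td : (t <= Num.truncn ((d%:R : R) `^ 4^-1))%N.
    rewrite truncn_ge_nat ?powR_ge0 //.
    by apply: le_trans tmin _; rewrite ge_min lexx orbT.
  rewrite -(ler_nat R); have := @truncn_root_le R d%:R 4 (ler0n _ _) isT.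
  apply: le_trans; rewrite -natrX ler_nat !expnS expn0 muln1 -!mulnA.
  by rewrite !leq_mul.
(* The counting assumes [t] positive; for zero copies the empty packing serves. *)
case: (posnP t) => [->|t0]; first exact: (@star1_copies G k d 0 set0 erefl).
apply: contrapT => nc.
have nS : ~ (exists A, pack (star1 (@tetrad G) k d) t A).
  by case=> A /star1_copies.
rewrite -Gn in kdn eG kn.
have := no_stars_sum (@sym_tetrad G) k0 d0 t0 kdn tk tttt nS.
move/(leq_trans (card_edge_le G)).
move: eG; rewrite -natrX -!natrM ler_nat => h1 h2.
have n0 : (0 < #|G|)%N by apply: leq_trans kn.
have : (0 < k * (#|G| * #|G| * #|G|))%N by rewrite !muln_gt0 k0 n0.
move: (leq_trans h1 h2); rewrite !expnS expn0 muln1.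
by clear; lia.
Qed.
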